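(* Suppose that $(\Gamma_0,\psi_0)\subsetneq(\Gamma_1,\psi_1)$ and $(\Gamma^*,\psi^* )$ are models of $T_{\log}$ (with $(\Gamma_0,\psi_0)$ a proper $L$-substructure of $(\Gamma_1,\psi_1)$) such that $(\Gamma^*,\psi^* )$ is $|\Gamma_1|^+$-saturated, and $i:(\Gamma_0,\psi_0)\to(\Gamma^*,\psi^* )$ is an embedding of $L$-structures. Then there is an element $\alpha\in\Gamma_1\setminus\Gamma_0$ such that $i$ extends to an embedding of $L$-structures $(\Gamma,\psi)\to(\Gamma^*,\psi^* )$ for some $L$-structure $(\Gamma,\psi)$ with $(\Gamma_0,\psi_0)\subseteq(\Gamma,\psi)\subseteq(\Gamma_1,\psi_1)$ (as $L$-substructures) and $\alpha\in\Gamma$.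
   Context: Asymptotic couples. An asymptotic couple is a pair $(\Gamma,\psi)$ where $\Gamma$ is a (totally) ordered abelian group and $\psi:\Gamma^{\neq}\to\Gamma$ (with $\Gamma^{\neq}=\Gamma\setminus\{0\}$) satisfies for all $\alpha,\beta\in\Gamma^{\neq}$: (AC1) $\alpha+\beta\neq0\Rightarrow\psi(\alpha+\beta)\geq\min(\psi(\alpha),\psi(\beta))$; (AC2) $\psi(r\alpha)=\psi(\alpha)$ for all nonzero $r\in\mathbb{Z}$; (AC3) $\alpha>0\Rightarrow\alpha+\psi(\alpha)>\psi(\beta)$. It is $H$-asymptotic (of $H$-type) if moreover $0<\alpha\leq\beta\Rightarrow\psi(\alpha)\geq\psi(\beta)$, and divisible if $\Gamma$ is divisible. Put $\Psi=\psi(\Gamma^{\neq})$ and $\gamma'=\gamma+\psi(\gamma)$ for $\gamma\in\Gamma^{\neq}$. $(\Gamma,\psi)$ has asymptotic integration if $\{\gamma':\gamma\in\Gamma^{\neq}\}=\Gamma$; if it is also of $H$-type, then for each $\alpha\in\Gamma$ there is a unique $\beta\in\Gamma^{\neq}$ with $\beta'=\alpha$, denoted $\int\alpha$, and the successor function is $s:\Gamma\to\Psi$, $s(\alpha)=\psi(\int\alpha)$; write $s\alpha=s(\alpha)$, so $s0=s(0)$. The theory $T_{\log}$. Let $L_0=\{0,+,-,<,\psi,\infty\}$. An asymptotic couple is an $L_0$-structure with underlying set $\Gamma_\infty=\Gamma\cup\{\infty\}$, $\Gamma<\infty$, and $\infty$ as default value: $-\infty=\gamma+\infty=\infty+\gamma=\infty+\infty=\psi(0)=\psi(\infty)=\infty$.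 $T_0$ is the $L_0$-theory whose models are the divisible $H$-asymptotic couples with asymptotic integration such that: $\Psi$ has a least element, equal to $s0$, and $s0>0$; every $\alpha\in\Psi$ has an immediate successor in the ordered set $\Psi$, namely $s\alpha$; and $\gamma\mapsto s\gamma:\Psi\to\Psi^{>s0}=\{x\in\Psi:x>s0\}$ is a bijection. For a model of $T_0$ let $p:\Psi^{>s0}\to\Psi$ be the inverse of this bijection, extended to $\Gamma_\infty$ by $p(\alpha)=\infty$ for $\alpha\in\Gamma_\infty\setminus\Psi^{>s0}$. Let $L=L_0\cup\{s,p,\delta_1,\delta_2,\dots\}$ with all new symbols unary function symbols; models of $T_0$ are construed as $L$-structures with $s$ interpreted as the successor function $\alpha\mapsto\psi(\int\alpha)$ on $\Gamma$ and $s(\infty)=\infty$, $p$ interpreted as the function $p:\Gamma_\infty\to\Gamma_\infty$ that inverts $\gamma\mapsto s\gamma:\Psi\to\Psi^{>s0}$ on $\Psi^{>s0}$ and takes the value $\infty$ elsewhere, and $\delta_n$ interpreted as division by $n$ ($\delta_n(\infty)=\infty$). $T_{\log}$ is the $L$-theory whose models are the models of $T_0$ so construed. *)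

(* Defs.v *)
From HB Require Import structures.
From mathcomp Require Import all_boot all_order all_algebra.
From mathcomp Require Import all_classical.

Set Implicit Arguments.
Unset Strict Implicit.
Unset Printing Implicit Defensive.

Import Order.TTheory GRing.Theory Num.Theory.

Local Open Scope classical_set_scope.
Local Open Scope card_scope.
Local Open Scope ring_scope.

(* Totally ordered abelian groups. *)

HB.mixin Record isOrderedAbelianGroup G of Num.POrderedZmodule G := {
  oag_le_total : forall x y : G, (x <= y) || (y <= x);
  oag_leD2l : forall z x y : G, x <= y -> z + x <= z + y
}.

#[short(type="oagType")]
HB.structure Definition OrderedAbelianGroup :=
  { G of Num.POrderedZmodule G & isOrderedAbelianGroup G }.

(* Asymptotic couples.  The map psi : G^{!=0} -> G is represented by a total
   function on G whose value at 0 is never used. *)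

Section AsymptoticCouple.
Variables (G : oagType) (psi : G -> G).

Record asymptotic_couple : Prop := {
  AC1 : forall a b, a != 0 -> b != 0 -> a + b != 0 ->
          Num.min (psi a) (psi b) <= psi (a + b);
  AC2 : forall a (r : int), a != 0 -> r != 0 -> psi (a *~ r) = psi a;
  AC3 : forall a b, b != 0 -> 0 < a -> psi b < a + psi a
}.

Definition H_type : Prop := forall a b, 0 < a -> a <= b -> psi b <= psi a.

Definition divisible : Prop :=
  forall (n : nat) (a : G), (0 < n)%N -> exists b, b *+ n = a.

Definition Psi : set G := [set psi g | g in [set g | g != 0]].

Definition acderiv (g : G) : G := g + psi g.

Definition asymptotic_integration : Prop :=
  acderiv @` [set g | g != 0] = [set: G].

(* The unique g != 0 with g + psi g = a, when the couple is of H-type with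
   asymptotic integration. *)
Definition integral (a : G) : G := xget 0 [set g | g != 0 /\ acderiv g = a].

Definition successor (a : G) : G := psi (integral a).

Definition Psi_gt_s0 : set G := [set x | Psi x /\ successor 0 < x].

Record T0_model : Prop := {
  T0_couple : asymptotic_couple;
  T0_Htype : H_type;
  T0_divisible : divisible;
  T0_integration : asymptotic_integration;
  T0_least : Psi (successor 0) /\ forall x, Psi x -> successor 0 <= x;
  T0_s0_gt0 : 0 < successor 0;
  T0_immediate_succ : forall a, Psi a ->
    [/\ Psi (successor a), a < successor a &
        forall b, Psi b -> ~ (a < b /\ b < successor a)];
  T0_succ_bij : set_bij Psi Psi_gt_s0 successor
}.

Definition predecessor (a : G) : G := xget 0 [set g | Psi g /\ successor g = a].

Definition divn_by (n : nat) (a : G) : G := xget 0 [set b | b *+ n = a].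

End AsymptoticCouple.

(* Structures for the language L = {0, +, -, <, psi, oo, s, p, delta_1, ...}.
   The field [Ldelta n] interprets delta_{n+1}. *)

Record Lstructure := {
  Lcarrier :> Type;
  Lzero : Lcarrier;
  Linf : Lcarrier;
  Ladd : Lcarrier -> Lcarrier -> Lcarrier;
  Lopp : Lcarrier -> Lcarrier;
  Llt : Lcarrier -> Lcarrier -> Prop;
  Lpsi : Lcarrier -> Lcarrier;
  Ls : Lcarrier -> Lcarrier;
  Lp : Lcarrier -> Lcarrier;
  Ldelta : nat -> Lcarrier -> Lcarrier
}.

Arguments Lzero : clear implicits.
Arguments Linf : clear implicits.

Record embedding (M N : Lstructure) (h : M -> N) : Prop := {
  emb_inj : injective h;
  emb_zero : h (Lzero M) = Lzero N;
  emb_inf : h (Linf M) = Linf N;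
  emb_add : forall x y, h (Ladd x y) = Ladd (h x) (h y);
  emb_opp : forall x, h (Lopp x) = Lopp (h x);
  emb_lt : forall x y, Llt x y <-> Llt (h x) (h y);
  emb_psi : forall x, h (Lpsi x) = Lpsi (h x);
  emb_s : forall x, h (Ls x) = Ls (h x);
  emb_p : forall x, h (Lp x) = Lp (h x);
  emb_delta : forall n x, h (Ldelta n x) = Ldelta n (h x)
}.

Definition isomorphic (M N : Lstructure) : Prop :=
  exists h : M -> N, embedding h /\ (forall y, exists x, h x = y).

Record substructure (M : Lstructure) := {
  sub_set :> Lcarrier M -> Prop;
  sub_zero : sub_set (Lzero M);
  sub_inf : sub_set (Linf M);
  sub_add : forall x y, sub_set x -> sub_set y -> sub_set (Ladd x y);
  sub_opp : forall x, sub_set x -> sub_set (Lopp x);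
  sub_psi : forall x, sub_set x -> sub_set (Lpsi x);
  sub_s : forall x, sub_set x -> sub_set (Ls x);
  sub_p : forall x, sub_set x -> sub_set (Lp x);
  sub_delta : forall n x, sub_set x -> sub_set (Ldelta n x)
}.

Definition induced (M : Lstructure) (S : substructure M) : Lstructure := {|
  Lcarrier := {x : M | S x};
  Lzero := exist _ _ (sub_zero S);
  Linf := exist _ _ (sub_inf S);
  Ladd := fun x y => exist _ _ (sub_add (proj2_sig x) (proj2_sig y));
  Lopp := fun x => exist _ _ (sub_opp (proj2_sig x));
  Llt := fun x y => Llt (proj1_sig x) (proj1_sig y);
  Lpsi := fun x => exist _ _ (sub_psi (proj2_sig x));
  Ls := fun x => exist _ _ (sub_s (proj2_sig x));
  Lp := fun x => exist _ _ (sub_p (proj2_sig x));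
  Ldelta := fun n x => exist _ _ (sub_delta n (proj2_sig x))
|}.

(* A couple (G, psi) construed as an L-structure on G_oo = option G, with None
   as oo. *)

Definition Lstructure_of (G : oagType) (psi : G -> G) : Lstructure := {|
  Lcarrier := option G;
  Lzero := Some 0;
  Linf := None;
  Ladd := fun x y =>
    match x, y with Some a, Some b => Some (a + b) | _, _ => None end;
  Lopp := omap (fun a => - a);
  Llt := fun x y =>
    match x, y with
    | Some a, Some b => is_true (a < b)
    | Some _, None => True
    | None, _ => False
    end;
  Lpsi := fun x =>
    match x with
    | Some a => if a == 0 then None else Some (psi a)
    | None => None
    end;
  Ls := omap (successor psi);
  Lp := fun x =>
    match x with
    | Some a =>
        if `[< Psi_gt_s0 psi a >] then Some (predecessor psi a) else None
    | None => None
    end;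
  Ldelta := fun n => omap (divn_by n.+1)
|}.

Definition Tlog_model (M : Lstructure) : Prop :=
  exists (G : oagType) (psi : G -> G),
    T0_model psi /\ isomorphic M (Lstructure_of psi).

(* First-order formulas of L with free variables in an arbitrary type V; a
   quantifier binds the variable None of [option V]. *)

Inductive term (V : Type) : Type :=
| Var of V
| Tzero
| Tinf
| Tadd of term V & term V
| Topp of term V
| Tpsi of term V
| Ts of term V
| Tp of term V
| Tdelta of nat & term V.

Inductive formula (V : Type) : Type :=
| Fbot
| Feq of term V & term V
| Flt of term V & term V
| Fimp of formula V & formula V
| Fall of formula (option V).

Fixpoint eval (M : Lstructure) (V : Type) (e : V -> M) (t : term V) : M :=
  match t with
  | Var v => e v
  | Tzero => Lzero M
  | Tinf => Linf M
  | Tadd t u => Ladd (eval e t) (eval e u)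
  | Topp t => Lopp (eval e t)
  | Tpsi t => Lpsi (eval e t)
  | Ts t => Ls (eval e t)
  | Tp t => Lp (eval e t)
  | Tdelta n t => Ldelta n (eval e t)
  end.

Definition extend (M : Lstructure) (V : Type) (e : V -> M) (x : M)
  (v : option V) : M := if v is Some w then e w else x.

Fixpoint sat (M : Lstructure) (V : Type) (e : V -> M) (f : formula V) : Prop :=
  match f with
  | Fbot => False
  | Feq t u => eval e t = eval e u
  | Flt t u => Llt (eval e t) (eval e u)
  | Fimp f g => sat e f -> sat e g
  | Fall f => forall x : M, sat (extend e x) f
  end.

(* An L_A-formula in one free variable x, with parameters from A : set M, is an
   element of [formula (option {a : M | A a})]: x is None, and the variables
   Some a are evaluated at the parameters themselves. *)

Definition param_formula (M : Lstructure) (A : set M) : Type :=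
  formula (option {a : M | A a}).

Definition sat_at (M : Lstructure) (A : set M) (x : M) (f : param_formula A) :
  Prop := sat (extend (@proj1_sig M A) x) f.

Definition type_realized (M : Lstructure) (A : set M)
  (Sigma : set (param_formula A)) : Prop :=
  exists x : M, forall f, Sigma f -> sat_at x f.

Definition finitely_satisfiable (M : Lstructure) (A : set M)
  (Sigma : set (param_formula A)) : Prop :=
  forall F : set (param_formula A),
    finite_set F -> F `<=` Sigma -> type_realized F.

(* |K|^+-saturation: |A| < |K|^+ means |A| <= |K|. *)
Definition succ_card_saturated (T : Type) (K : set T) (M : Lstructure) : Prop :=
  forall (A : set M) (Sigma : set (param_formula A)),
    A #<= K -> finitely_satisfiable Sigma -> type_realized Sigma.

(* Main.v *)
Require Import Defs.
From HB Require Import structures.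
From mathcomp Require Import all_boot all_order all_algebra.
From mathcomp Require Import all_classical.
From mathcomp Require Import ring zify.

(* Write A, B, C for the couples of G0, G1 and Gstar, with f : A -> B the
   inclusion and g : A -> C the map i.  Since s x is the only t such that
   psi (x - t) = t, an extension of g to a divisible subgroup of B closed under
   psi, s and p is an L-embedding as soon as it preserves <, + and psi.

   If psi(B) = psi(A), any alpha in B \ A will do.  The type of alpha over A is
   given by its cut and by the values psi (alpha - a), which lie in A; finitely
   many of these conditions are satisfied in A itself, by a point close enough
   to the element of A nearest to alpha, or between the two nearest ones.  A
   realization in C extends g to A + Q alpha.

   Otherwise take alpha in psi(B) \ psi(A), and realize in psi(C) the cut of alpha
   in psi(A); this is finitely satisfied because that cut is closed under s.  The
   iterates c k of alpha under s and p, k in Z, all lie in that cut.  As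
   psi (c j - c k) = c (j + 1) for j < k, an element of A + sum_k Q (c k) is a
   sum of an element of A + Q (c m) and of multiples of c (j - 1) - c j for
   j <= m, with pairwise distinct values of psi; so its sign and the value of
   psi are those of its term of least value, and they are determined by the
   cut. *)

Set Implicit Arguments.
Unset Strict Implicit.
Unset Printing Implicit Defensive.
Import Order.TTheory GRing.Theory Num.Theory.
Local Open Scope classical_set_scope.
Local Open Scope card_scope.
Local Open Scope ring_scope.

(** * Integer-linear identities *)

(* Square-zero extension of the integers by M.  It is a commutative ring
   containing M, so [ring] proves integer-linear identities in M. *)
Definition sqzero_ext (M : zmodType) : Type := (int * M)%type.

Section SquareZeroExtension.
Variable M : zmodType.
HB.instance Definition _ := GRing.Zmodule.on (sqzero_ext M).

Definition sqzero_mul (x y : sqzero_ext M) : sqzero_ext M :=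
  (x.1 * y.1, y.2 *~ x.1 + x.2 *~ y.1).

Fact sqzero_mulA : associative sqzero_mul.
Proof.
move=> [a x] [b y] [c z]; rewrite /sqzero_mul /=; congr pair; first exact: mulrA.
by rewrite !mulrzDl -!mulrzA addrA (mulrC b a) (mulrC c a).
Qed.

Fact sqzero_mulC : commutative sqzero_mul.
Proof. by move=> [a x] [b y]; rewrite /sqzero_mul /= mulrC addrC. Qed.

Fact sqzero_mul1r : left_id ((1, 0) : sqzero_ext M) sqzero_mul.
Proof. by move=> [a x]; rewrite /sqzero_mul /= mul1r mulr1z mul0rz addr0. Qed.

Fact sqzero_mulDl : left_distributive sqzero_mul +%R.
Proof.
move=> [a x] [b y] [c z]; rewrite /sqzero_mul /=; congr pair; first exact: mulrDl.
by rewrite mulrzDr mulrzDl addrACA.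
Qed.

Fact sqzero_1neq0 : ((1, 0) : sqzero_ext M) != 0.
Proof. by apply/eqP => -[]. Qed.

HB.instance Definition _ := GRing.Zmodule_isComNzRing.Build (sqzero_ext M)
  sqzero_mulA sqzero_mulC sqzero_mul1r sqzero_mulDl sqzero_1neq0.

Definition sqzero_in (x : M) : sqzero_ext M := (0, x).

Fact sqzero_in_additive : zmod_morphism sqzero_in.
Proof. by move=> x y; congr pair; rewrite subr0. Qed.

HB.instance Definition _ :=
  GRing.isZmodMorphism.Build M (sqzero_ext M) sqzero_in sqzero_in_additive.

Lemma sqzero_in_inj : injective sqzero_in.
Proof. by move=> x y []. Qed.
End SquareZeroExtension.

Lemma sqzero_inMz (M : zmodType) (x : M) (n : int) :
  sqzero_in (x *~ n) = sqzero_in x * n%:~R.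
Proof. by rewrite raddfMz mulrzr. Qed.

Ltac zring := apply: sqzero_in_inj; rewrite ?sqzero_inMz; ring.

(** * Ordered groups and asymptotic couples *)

Section OrderedGroup.
Variable G : oagType.
Implicit Types x y z : G.

Lemma oag_ltP x y : [\/ x < y, x = y | y < x].
Proof.
have c : x >=< y by rewrite /Order.comparable oag_le_total.
by case: (comparable_ltgtP c) => h; [constructor 1|constructor 3|constructor 2].
Qed.

Lemma oag_leNgt x y : (x <= y) = ~~ (y < x).
Proof. by apply: comparable_leNgt; rewrite /Order.comparable oag_le_total. Qed.

Lemma oag_ltD2l z x y : (z + x < z + y) = (x < y).
Proof.
rewrite !lt_def (inj_eq (addrI z)); congr andb.
apply/idP/idP => [/(oag_leD2l (- z))|/(oag_leD2l z)//].
by rewrite !addKr.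
Qed.

Lemma oag_subr_gt0 x y : (0 < y - x) = (x < y).
Proof. by rewrite -(oag_ltD2l x 0 (y - x)) addr0 addrCA subrr addr0. Qed.

Lemma oag_subr_lt0 x y : (y - x < 0) = (y < x).
Proof. by rewrite -(oag_ltD2l x (y - x) 0) addr0 addrCA subrr addr0. Qed.

Lemma oag_oppr_gt0 x : (0 < - x) = (x < 0).
Proof. by rewrite -sub0r oag_subr_gt0. Qed.

Lemma oag_oppr_lt0 x : (- x < 0) = (0 < x).
Proof. by rewrite -sub0r oag_subr_lt0. Qed.

Lemma oag_addr_gt0 x y : 0 < x -> 0 < y -> 0 < x + y.
Proof. by move=> x0 y0; apply: (lt_trans x0); rewrite -{1}(addr0 x) oag_ltD2l. Qed.

Lemma oag_mulrn_gt0 x n : 0 < x -> 0 < x *+ n.+1.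
Proof.
move=> x0; elim: n => [|n IH]; first by rewrite mulr1n.
by rewrite mulrS; apply: oag_addr_gt0.
Qed.

Lemma oag_mulrz_gt0 x (n : int) : 0 < x -> 0 < n -> 0 < x *~ n.
Proof. by case: n => [[|n]|n] // x0 _; apply: oag_mulrn_gt0. Qed.

Lemma oag_pmulrz_gt0 x (n : int) : 0 < n -> (0 < x *~ n) = (0 < x).
Proof.
move=> n0; apply/idP/idP => [xn|]; last by move=> x0; apply: oag_mulrz_gt0.
case: (oag_ltP 0 x) => // [x0|]; first by rewrite -x0 mul0rz ltxx in xn.
rewrite -oag_oppr_gt0 => /oag_mulrz_gt0 /(_ n0).
by rewrite mulNrz oag_oppr_gt0 => /(lt_trans xn); rewrite ltxx.
Qed.

Lemma oag_nmulrz_gt0 x (n : int) : n < 0 -> (0 < x *~ n) = (x < 0).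
Proof.
move=> n0; have n0' : 0 < - n by rewrite oppr_gt0.
by rewrite -(oag_oppr_gt0 x) -(oag_pmulrz_gt0 (- x) n0') mulrNz mulNrz opprK.
Qed.

Lemma oag_mulrz_eq0 x (n : int) : n != 0 -> x *~ n = 0 -> x = 0.
Proof.
move=> nz xn; have xn0 : (0 < x *~ n) = false by rewrite xn ltxx.
have xn0' : (0 < (- x) *~ n) = false by rewrite mulNrz xn oppr0 ltxx.
case: (oag_ltP x 0) => // x0; case: (ltgtP n 0) nz => // n0 _.
- by rewrite oag_nmulrz_gt0 // x0 in xn0.
- by rewrite oag_pmulrz_gt0 // oag_oppr_gt0 x0 in xn0'.
- by rewrite oag_nmulrz_gt0 // oag_oppr_lt0 x0 in xn0'.
- by rewrite oag_pmulrz_gt0 // x0 in xn0.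
Qed.

Lemma oag_mulrz_inj x y (n : int) : n != 0 -> x *~ n = y *~ n -> x = y.
Proof.
move=> nz h; apply/eqP; rewrite -subr_eq0; apply/eqP.
by apply: (oag_mulrz_eq0 nz); rewrite mulrzBl h subrr.
Qed.

End OrderedGroup.

(** [x] and [y] are the same rational multiple of [u] and of [v], so it suffices to carry signs from
    [u] to [v]. Signs are transferred to a divisible hull in this way. *)
Lemma same_multiple_gt0 (G H : oagType) (x u : G) (y v : H) (n m : int) :
  n != 0 -> m != 0 -> x *~ n = u *~ m -> y *~ n = v *~ m ->
  (0 < u -> 0 < v) -> (u < 0 -> v < 0) -> 0 < x -> 0 < y.
Proof.
wlog n0 : n m / 0 < n => [W|].
  case: (ltgtP n 0) => // [n0 _ mz xu yv|n0]; last first.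
    by move=> _; apply: W; rewrite ?(gt_eqF n0).
  by apply: (W (- n) (- m)); rewrite ?oppr_gt0 ?oppr_eq0 ?(lt_eqF n0) ?mulrNz ?xu ?yv.
move=> _ mz xu yv pos neg.
rewrite -(oag_pmulrz_gt0 x n0) -(oag_pmulrz_gt0 y n0) xu yv.
case: (ltgtP m 0) mz => // m0 _; first by rewrite !oag_nmulrz_gt0.
by rewrite !oag_pmulrz_gt0.
Qed.

(** * Dominance of the term with the least value of [psi] *)

Section Couple.
Variables (G : oagType) (psi : G -> G).
Hypotheses (ac : asymptotic_couple psi) (Ht : H_type psi).
Implicit Types a b x y t : G.

Lemma psiMz a (r : int) : r != 0 -> a != 0 -> psi (a *~ r) = psi a.
Proof. by move=> r0 a0; apply: (AC2 ac). Qed.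

Lemma psiN a : a != 0 -> psi (- a) = psi a.
Proof. by move=> a0; rewrite -(@psiMz a (-1)) // mulrNz mulr1z. Qed.

Lemma psi_multiple x u (n m : int) :
  n != 0 -> m != 0 -> x *~ n = u *~ m -> x != 0 -> psi x = psi u.
Proof.
move=> n0 m0 xu x0; rewrite -(psiMz n0 x0) xu psiMz //.
apply: contra_neq x0 => u0; apply: (oag_mulrz_eq0 n0).
by rewrite xu u0 mul0rz.
Qed.

(* The sets [{a | psi a >= t}] and [{a | psi a > t}], with psi 0 = oo. *)
Definition psige t a := a != 0 -> t <= psi a.
Definition psigt t a := a != 0 -> t < psi a.

Lemma psigeD t a b : psige t a -> psige t b -> psige t (a + b).
Proof.
move=> ta tb ab; have [a0|a0] := eqVneq a 0.
  by move: ab; rewrite a0 add0r; apply: tb.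
have [b0|b0] := eqVneq b 0; first by move: ab; rewrite b0 addr0; apply: ta.
by apply: le_trans (AC1 ac a0 b0 ab); rewrite /Num.min; case: ifP => _; auto.
Qed.

Lemma psigtD t a b : psigt t a -> psigt t b -> psigt t (a + b).
Proof.
move=> ta tb ab; have [a0|a0] := eqVneq a 0.
  by move: ab; rewrite a0 add0r; apply: tb.
have [b0|b0] := eqVneq b 0; first by move: ab; rewrite b0 addr0; apply: ta.
by apply: lt_le_trans (AC1 ac a0 b0 ab); rewrite /Num.min; case: ifP => _; auto.
Qed.

Lemma psigeN t a : psige t a -> psige t (- a).
Proof. by move=> ta; rewrite /psige oppr_eq0 => a0; rewrite psiN //; apply: ta. Qed.

Lemma psigtN t a : psigt t a -> psigt t (- a).
Proof. by move=> ta; rewrite /psigt oppr_eq0 => a0; rewrite psiN //; apply: ta. Qed.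

Lemma psigtB t a b : psigt t a -> psigt t b -> psigt t (a - b).
Proof. by move=> ta tb; apply: psigtD => //; apply: psigtN. Qed.

Lemma psigt_ge t a : psigt t a -> psige t a.
Proof. by move=> h /h /ltW. Qed.

(** If [d] outweighed [a] with the opposite sign, type H would give [psi d <= psi a]; this settles
    the sign. (AC1) applied to [a + d] and to [a = (a + d) - d] gives the two inequalities for the
    value. *)
Lemma psi_dominant a d : a != 0 -> psigt (psi a) d ->
  [/\ a + d != 0, psi (a + d) = psi a & (0 < a + d) = (0 < a)].
Proof.
move=> a0 ad.
have ad0 : a + d != 0.
  apply/eqP => /eqP; rewrite addrC addr_eq0 => /eqP da.
  by move: ad; rewrite da /psigt oppr_eq0 psiN // ltxx => /(_ a0).
have gt_pos b e : 0 < b -> psigt (psi b) e -> 0 < b + e.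
  move=> b0 be; case: (oag_ltP 0 (b + e)) => // [be0|be0].
    move: be; rewrite (_ : e = - b) => [|]; last by apply/eqP; rewrite -addr_eq0 addrC -be0.
    by rewrite /psigt oppr_eq0 psiN ?gt_eqF // ltxx => /(_ isT).
  have eb : b < - e by rewrite -oag_subr_gt0 (_ : - e - b = - (b + e)) ?oag_oppr_gt0 //; zring.
  have e0 : e != 0.
    by apply/eqP => e0; move: eb; rewrite e0 oppr0 => /(lt_trans b0); rewrite ltxx.
  have := Ht b0 (ltW eb); rewrite psiN // => /(lt_le_trans (be e0)).
  by rewrite ltxx.
split=> //.
  apply/eqP; rewrite eq_le; apply/andP; split; last first.
    by apply: (@psigeD (psi a)) ad0 => //; apply: psigt_ge.
  rewrite oag_leNgt; apply/negP => lt_a.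
  have : psigt (psi a) (a + d - d) by apply: psigtB => // _.
  by rewrite addrK => /(_ a0); rewrite ltxx.
apply/idP/idP => [h|h]; last exact: gt_pos.
case: (oag_ltP 0 a) => // [a00|an0]; first by rewrite -a00 eqxx in a0.
have := gt_pos (- a) (- d); rewrite oag_oppr_gt0 => /(_ an0).
rewrite psiN // => /(_ (psigtN ad)); rewrite -opprD oag_oppr_gt0.
by move/(lt_trans h); rewrite ltxx.
Qed.

Lemma psi_dominant_lt0 a d : a != 0 -> psigt (psi a) d -> (a + d < 0) = (a < 0).
Proof.
move=> a0 ad; rewrite -!oag_oppr_gt0 opprD.
by case: (@psi_dominant (- a) (- d)) => //; rewrite ?oppr_eq0 ?psiN //; apply: psigtN.
Qed.

Lemma psiD_le a d : a != 0 -> (d != 0 -> psi d != psi a) ->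
  a + d != 0 /\ psi (a + d) <= psi a.
Proof.
move=> a0 dn; case: (oag_ltP (psi d) (psi a)) => h.
- have [d0|d0] := eqVneq d 0; first by rewrite d0 addr0.
  have [h1 h2 _] := @psi_dominant d a d0 (fun _ => h).
  by rewrite addrC h1 h2 ltW.
- have [d0|d0] := eqVneq d 0; first by rewrite d0 addr0.
  by have := dn d0; rewrite h eqxx.
- by have [h1 -> _] := @psi_dominant a d a0 (fun _ => h).
Qed.

End Couple.

(** * The successor function in a model *)

Section Model.
Variables (G : oagType) (psi : G -> G).
Hypothesis T : T0_model psi.
Let ac := T0_couple T.
Let Ht := T0_Htype T.
Local Notation s := (successor psi).
Local Notation Psi := (Psi psi).
Implicit Types a b x y t : G.

Lemma Psi_psi a : a != 0 -> Psi (psi a).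
Proof. by move=> a0; exists a. Qed.

(** [x - s x] is the integral [h] of [x], since [x = h + psi h] and [s x = psi h]. *)
Lemma integralE x : x - s x != 0 /\ psi (x - s x) = s x.
Proof.
have : [set: G] x by [].
rewrite -(T0_integration T) => -[g /= g0 gx].
have [] : [set h | h != 0 /\ acderiv psi h = x] (integral psi x).
  by apply: (@xgetPex _ 0); exists g.
rewrite /acderiv /successor; move: (integral psi x) => h h0 hx.
by rewrite -{1 2}hx addrK.
Qed.

Lemma Psi_s x : Psi (s x).
Proof. by have [x0 <-] := integralE x; apply: Psi_psi. Qed.

(** For two solutions [u < v], the value of [v - u = (x - u) - (x - v)] is [u], and (AC3) would give
    [v < (v - u) + u]. *)
Lemma s_unique x t : x - t != 0 -> psi (x - t) = t -> s x = t.
Proof.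
have key u v : x - u != 0 -> psi (x - u) = u -> x - v != 0 -> psi (x - v) = v ->
    ~ u < v.
  move=> u0 ue v0 ve uv.
  have := @AC3 _ _ ac (v - u) (x - v) v0; rewrite oag_subr_gt0 => /(_ uv).
  rewrite ve.
  have [|_ h _] := @psi_dominant _ _ ac Ht (x - u) (- (x - v)) u0.
    by rewrite ue; apply: (psigtN ac) => _; rewrite ve.
  have -> : v - u = x - u - (x - v) by zring.
  by rewrite h ue (_ : _ + u = v) ?ltxx //; zring.
have [x0 xe] := integralE x => t0 te.
by case: (oag_ltP (s x) t) => // h; exfalso; [apply: (key (s x) t)|apply: (key t (s x))].
Qed.

(** Write [y - x] as [- (x - s x)] plus [(y - s y) + (s y - s x)]. The first term has value [s x];
    the other two have larger values, by (AC3) for the last one, so the first dominates. *)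
Lemma s_lt_psiB x y : s x < s y -> psi (y - x) = s x /\ (0 < y - x) = (x < s x).
Proof.
move=> xy; have [x0 xe] := integralE x; have [y0 ye] := integralE y.
have st : psigt psi (s x) (s y - s x).
  move=> st0; have := @AC3 _ _ ac (s y - s x) (y - s y) y0.
  rewrite oag_subr_gt0 ye => /(_ xy).
  by rewrite -oag_subr_gt0 (_ : _ - _ = psi (s y - s x) - s x) ?oag_subr_gt0 //; zring.
have [||_ h1 h2] := @psi_dominant _ _ ac Ht (- (x - s x)) ((y - s y) + (s y - s x)).
- by rewrite oppr_eq0.
- by rewrite psiN // xe; apply: (psigtD ac) => // _; rewrite ye.
have e : - (x - s x) + (y - s y + (s y - s x)) = y - x by zring.
by move: h1 h2; rewrite e (psiN ac x0) xe oag_oppr_gt0 oag_subr_lt0.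
Qed.

Lemma s_gt_psigt t x y : t < s x -> t < s y -> psigt psi t (x - y).
Proof.
move=> tx ty xy; case: (oag_ltP (s x) (s y)) => h.
- by rewrite -psiN // opprB (s_lt_psiB h).1.
- have [x0 xe] := integralE x; have [y0 ye] := integralE y.
  rewrite (_ : x - y = (x - s x) - (y - s y)) in xy *; last by rewrite h; zring.
  by apply: (psigtB ac) xy => _; rewrite ?xe ?ye.
- by rewrite (s_lt_psiB h).1.
Qed.

Lemma Psi_lt_s b : Psi b -> b < s b.
Proof. by case/(T0_immediate_succ T). Qed.

Lemma Psi_s_le b c : Psi b -> Psi c -> b < c -> s b <= c.
Proof.
move=> Pb Pc bc; rewrite oag_leNgt; apply/negP => cs.
by case: (T0_immediate_succ T Pb) => _ _ /(_ c Pc); apply.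
Qed.

Lemma Psi_s_inj b c : Psi b -> Psi c -> s b = s c -> b = c.
Proof. by move=> Pb Pc; case: (T0_succ_bij T) => _ inj _; apply: inj; rewrite inE. Qed.

Lemma Psi_cases x : Psi x -> x = s 0 \/ exists2 y, Psi y & s y = x.
Proof.
move=> Px; case: (oag_ltP (s 0) x) => [h|->|h]; [right|by left|].
- case: (T0_succ_bij T) => _ _ /(_ x) []; first by split.
  by move=> y Py <-; exists y.
- by have := (T0_least T).2 x Px; rewrite oag_leNgt h.
Qed.

Lemma s0_lt_s b : Psi b -> s 0 < s b.
Proof. by move=> Pb; apply: le_lt_trans (Psi_lt_s Pb); apply: (T0_least T).2. Qed.

Lemma predecessorE x : Psi_gt_s0 psi x ->
  Psi (predecessor psi x) /\ s (predecessor psi x) = x.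
Proof.
move=> [Px x0]; apply: (@xgetPex _ 0 [set g | Psi g /\ s g = x]).
case: (Psi_cases Px) => [xs|[y Py <-]]; first by rewrite xs ltxx in x0.
by exists y.
Qed.

Lemma divisible_mulrz (m : int) x : m != 0 -> exists w, w *~ m = x.
Proof.
case: m => [[|n]|n] // _; have [b bx] := T0_divisible T x (ltn0Sn n).
  by exists b.
by exists (- b); rewrite NegzE mulrNz mulNrz opprK.
Qed.

End Model.

(** * Embeddings and partial isomorphisms *)

Record couple_embedding (A B : oagType) (psiA : A -> A) (psiB : B -> B)
    (f : A -> B) : Prop := {
  ce_add : forall x y, f (x + y) = f x + f y;
  ce_lt : forall x y, x < y -> f x < f y;
  ce_psi : forall x, x != 0 -> f (psiA x) = psiB (f x)
}.

Section Embedding.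
Variables (A B : oagType) (psiA : A -> A) (psiB : B -> B) (f : A -> B).
Hypotheses (TA : T0_model psiA) (TB : T0_model psiB).
Hypothesis fE : couple_embedding psiA psiB f.
Local Notation sA := (successor psiA).
Local Notation sB := (successor psiB).

Lemma ce_0 : f 0 = 0.
Proof. by apply: (addrI (f 0)); rewrite -(ce_add fE) !addr0. Qed.

Lemma ce_N x : f (- x) = - f x.
Proof. by apply: (addrI (f x)); rewrite -(ce_add fE) !subrr ce_0. Qed.

Lemma ce_B x y : f (x - y) = f x - f y.
Proof. by rewrite (ce_add fE) ce_N. Qed.

Lemma ce_Mz x (n : int) : f (x *~ n) = f x *~ n.
Proof.
have nat_case k : f (x *+ k) = f x *+ k.
  by elim: k => [|k IH]; rewrite ?mulr0n ?ce_0 // !mulrS (ce_add fE) IH.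
case: n => n; first exact: nat_case.
by rewrite NegzE !mulrNz ce_N; congr (- _); apply: nat_case.
Qed.

Lemma ce_ltE x y : (f x < f y) = (x < y).
Proof.
apply/idP/idP => [fxy|]; last exact: (ce_lt fE).
case: (oag_ltP x y) => // [xy|/(ce_lt fE)/(lt_trans fxy)]; last by rewrite ltxx.
by rewrite xy ltxx in fxy.
Qed.

Lemma ce_leE x y : (f x <= f y) = (x <= y).
Proof. by rewrite !oag_leNgt ce_ltE. Qed.

Lemma ce_inj : injective f.
Proof.
by move=> x y xy; case: (oag_ltP x y) => // /(ce_lt fE); rewrite xy ltxx.
Qed.

Lemma ce_neq0 x : (f x != 0) = (x != 0).
Proof. by rewrite -ce_0 (inj_eq ce_inj). Qed.

Lemma ce_s x : f (sA x) = sB (f x).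
Proof.
have [x0 xe] := integralE TA x; apply/esym/(s_unique TB).
  by rewrite -ce_B ce_neq0.
by rewrite -ce_B -(ce_psi fE) // xe.
Qed.

(** For the direct implication, [sA a] is in [Psi psiA] and differs from [s 0], so it is [s w] with
    [w] in [Psi psiA]; as [s] is injective on [Psi psiB], [f w = f a]. *)
Lemma ce_PsiE a : Psi psiB (f a) <-> Psi psiA a.
Proof.
have sub b : Psi psiA b -> Psi psiB (f b).
  by move=> [g /= g0 <-]; rewrite (ce_psi fE) //; apply: Psi_psi; rewrite ce_neq0.
split; last exact: sub.
move=> Pfa; have Psa : Psi psiA (sA a) by apply: Psi_s.
case: (Psi_cases TA Psa) => [sa|[w Pw ws]].
  have := s0_lt_s TB Pfa; rewrite -ce_s sa ce_s ce_0; by rewrite ltxx.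
suff /ce_inj <- : f w = f a by [].
by apply: (Psi_s_inj TB) => //; [apply: sub|rewrite -!ce_s ws].
Qed.

End Embedding.

Section PartialIso.
Variables (B C : oagType).
Implicit Types R S V : B -> C -> Prop.

(* Divisible subgroup of B * C. *)
Record linear_rel R : Prop := {
  lr_0 : R 0 0;
  lr_D : forall x y x' y', R x y -> R x' y' -> R (x + x') (y + y');
  lr_N : forall x y, R x y -> R (- x) (- y);
  lr_div : forall x y (n : int), n != 0 -> R (x *~ n) (y *~ n) -> R x y
}.

Lemma lr_B R x y x' y' : linear_rel R -> R x y -> R x' y' -> R (x - x') (y - y').
Proof. by move=> L xy /(lr_N L); apply: lr_D. Qed.

Lemma lr_Mz R x y (n : int) : linear_rel R -> R x y -> R (x *~ n) (y *~ n).
Proof.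
move=> L xy; have nat_case k : R (x *+ k) (y *+ k).
  elim: k => [|k IH]; first by rewrite !mulr0n; apply: lr_0.
  by rewrite !mulrS; apply: lr_D.
case: n => n; first exact: nat_case.
by rewrite NegzE !mulrNz; apply: lr_N => //; apply: nat_case.
Qed.

(* Divisible hull of the group generated by R and (a, b). *)
Definition adjoin R a b : B -> C -> Prop := fun x y =>
  exists n m : int, n != 0 /\ R (x *~ n - a *~ m) (y *~ n - b *~ m).

Lemma adjoin_sub R a b x y : linear_rel R -> R x y -> adjoin R a b x y.
Proof. by move=> L xy; exists 1, 0; split => //; rewrite !mulr1z !mulr0z !subr0. Qed.

Lemma adjoin_gen R a b : linear_rel R -> adjoin R a b a b.
Proof. by move=> L; exists 1, 1; split => //; rewrite !mulr1z !subrr; apply: lr_0. Qed.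

Lemma adjoin_linear R a b : linear_rel R -> linear_rel (adjoin R a b).
Proof.
move=> L; split.
- by apply: adjoin_sub => //; apply: lr_0.
- move=> x y x' y' [n [m [n0 r]]] [n' [m' [n0' r']]].
  exists (n * n'), (m * n' + m' * n); split; first by rewrite mulf_neq0.
  have := lr_D L (lr_Mz n' L r) (lr_Mz n L r').
  by congr R; zring.
- move=> x y [n [m [n0 r]]]; exists n, (- m); split => //.
  by have := lr_N L r; congr R; zring.
- move=> x y k k0 [n [m [n0 r]]]; exists (k * n), m; split; first by rewrite mulf_neq0.
  by rewrite !mulrzA.
Qed.

Lemma adjoin_min R S a b : linear_rel S -> (forall x y, R x y -> S x y) -> S a b ->
  forall x y, adjoin R a b x y -> S x y.
Proof.
move=> L RS ab x y [n [m [n0 r]]]; apply: (lr_div L n0).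
have := lr_D L (RS _ _ r) (lr_Mz m L ab).
by congr S; zring.
Qed.

Variables (psiB : B -> B) (psiC : C -> C).
Hypotheses (TB : T0_model psiB) (TC : T0_model psiC).

(** [V] relates the values of [psi]. It is kept apart from [R] because the group of an intermediate
    stage need not contain its own values. *)
Record partial_iso R V : Prop := {
  pi_linear :> linear_rel R;
  pi_zero : forall y, R 0 y -> y = 0;
  pi_pos : forall x y, R x y -> 0 < x -> 0 < y;
  pi_psi : forall x y, R x y -> x != 0 -> V (psiB x) (psiC y)
}.

Lemma pi_neg R V x y : partial_iso R V -> R x y -> x < 0 -> y < 0.
Proof.
move=> P xy; rewrite -!oag_oppr_gt0; apply: (pi_pos P).
exact: (lr_N P).
Qed.

Lemma pi_neq0 R V x y : partial_iso R V -> R x y -> x != 0 -> y != 0.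
Proof.
move=> P xy; case: (oag_ltP x 0) => [/(pi_neg P xy)/lt_eqF->//|->|/(pi_pos P xy)/gt_eqF->//].
by rewrite eqxx.
Qed.

(** A point of the hull outside the domain of [R] is a rational multiple of some [a - w] with [w] in
    that domain. It has the same value of [psi], and its sign is that of [a - w] up to the sign of
    the factor, so only the differences [a - x] need checking. *)
Lemma adjoin_iso R V V' a b :
  partial_iso R V -> (forall u v, V u v -> V' u v) ->
  (forall x y, R x y -> [/\ a != x, x < a -> y < b, a < x -> b < y &
     V' (psiB (a - x)) (psiC (b - y))]) ->
  partial_iso (adjoin R a b) V'.
Proof.
move=> P VV' ab; have L := pi_linear P.
have decomp x y : adjoin R a b x y -> R x y \/
    exists n m w z, [/\ n != 0, m != 0 & R w z] /\
      [/\ x *~ n = (a - w) *~ m & y *~ n = (b - z) *~ m].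
  move=> [n [m [n0 r]]]; have [m0|m0] := eqVneq m 0.
    left; apply: (lr_div L n0); move: r.
    by rewrite m0 !mulr0z !subr0.
  right; have [w wE] := divisible_mulrz TB (- (x *~ n - a *~ m)) m0.
  have [z zE] := divisible_mulrz TC (- (y *~ n - b *~ m)) m0.
  exists n, m, w, z; split; first split=> //.
    by apply: (lr_div L m0); rewrite wE zE; apply: (lr_N L).
  by rewrite !mulrzBl wE zE; split; zring.
have a_b x y : R x y -> (0 < a - x -> 0 < b - y) /\ (a - x < 0 -> b - y < 0).
  by rewrite !oag_subr_gt0 !oag_subr_lt0 => /ab[].
have nz x y : R x y -> b - y != 0.
  move=> xy; have [ax h1 h2 _] := ab _ _ xy; rewrite subr_eq0.
  by case: (oag_ltP a x) => [/h2/lt_eqF->|e|/h1/gt_eqF->] //; rewrite e eqxx in ax.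
split; first exact: adjoin_linear.
- move=> y /decomp [|[n [m [w [z [[n0 m0 wz] [xE yE]]]]]]]; first exact: (pi_zero P).
  have [/eqP aw _ _ _] := ab _ _ wz; case: aw.
  apply/eqP; rewrite -subr_eq0; apply/eqP.
  by apply: (oag_mulrz_eq0 m0); rewrite -xE mul0rz.
- move=> x y /decomp [|[n [m [w [z [[n0 m0 wz] [xE yE]]]]]]]; first exact: (pi_pos P).
  by have [h1 h2] := a_b _ _ wz; apply: (same_multiple_gt0 n0 m0 xE yE).
- move=> x y /decomp [/(pi_psi P) h /h /VV'//|].
  move=> [n [m [w [z [[n0 m0 wz] [xE yE]]]]]] x0.
  rewrite (psi_multiple (T0_couple TB) n0 m0 xE x0).
  rewrite (psi_multiple (T0_couple TC) n0 m0 yE); first by case: (ab _ _ wz).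
  apply: contra_neq (nz _ _ wz) => y0; apply: (oag_mulrz_eq0 m0).
  by rewrite -yE y0 mul0rz.
Qed.

End PartialIso.

Section Base.
Variables (A B C : oagType) (psiA : A -> A) (psiB : B -> B) (psiC : C -> C).
Variables (f : A -> B) (g : A -> C).
Hypotheses (TA : T0_model psiA) (TB : T0_model psiB) (TC : T0_model psiC).
Hypotheses (fE : couple_embedding psiA psiB f) (gE : couple_embedding psiA psiC g).

Definition base_rel : B -> C -> Prop := fun x y => exists a, x = f a /\ y = g a.

Definition base_Psi : B -> C -> Prop :=
  fun x y => exists a, [/\ Psi psiA a, x = f a & y = g a].

Lemma base_iso : partial_iso psiB psiC base_rel base_Psi.
Proof.
split; first split.
- by exists 0; rewrite (ce_0 fE) (ce_0 gE).
- move=> _ _ _ _ [a [-> ->]] [b [-> ->]]; exists (a + b).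
  by rewrite (ce_add fE) (ce_add gE).
- by move=> _ _ [a [-> ->]]; exists (- a); rewrite (ce_N fE) (ce_N gE).
- move=> x y n n0 [a [xa ya]]; have [w wa] := divisible_mulrz TA a n0.
  exists w; split; apply: (oag_mulrz_inj n0).
    by rewrite xa -wa (ce_Mz fE).
  by rewrite ya -wa (ce_Mz gE).
- by move=> y [a []]; rewrite -{1}(ce_0 fE) => /(ce_inj fE) <- ->; rewrite (ce_0 gE).
- by move=> _ _ [a [-> ->]]; rewrite -{1}(ce_0 fE) -(ce_0 gE) (ce_ltE fE) (ce_ltE gE).
- move=> _ _ [a [-> ->]]; rewrite (ce_neq0 fE) => a0; exists (psiA a).
  by rewrite (ce_psi fE) // (ce_psi gE) //; split => //; apply: Psi_psi.
Qed.

End Base.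

(** * Extensions without new values of psi *)

Lemma seq_maximum (T : eqType) (r : rel T) (P : pred T) (l : seq T) :
  total r -> transitive r ->
  (forall a, a \in l -> ~~ P a) \/
  exists m, [/\ m \in l, P m & forall a, a \in l -> P a -> r a m].
Proof.
move=> rtot rtr; elim: l => [|b l [IH|[m [ml Pm mmax]]]]; first by left.
  have [Pb|nPb] := boolP (P b); [right; exists b|left] => [|a].
    split=> [||a]; rewrite ?mem_head // inE => /orP[/eqP->|/IH/negP//].
    by have /orP[] := rtot b b.
  by rewrite inE => /orP[/eqP->|/IH].
right; have [Pb|nPb] := boolP (P b); last first.
  exists m; split; rewrite ?inE ?ml ?orbT // => a.
  by rewrite inE => /orP[/eqP->|]; [rewrite (negPf nPb)|exact: mmax].
case/orP: (rtot b m) => bm; [exists m|exists b]; split; rewrite ?inE ?ml ?eqxx ?orbT //.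
  by move=> a; rewrite inE => /orP[/eqP->//|]; exact: mmax.
move=> a; rewrite inE => /orP[/eqP-> _|al Pa]; first by have /orP[] := rtot b b.
exact: rtr (mmax _ al Pa) bm.
Qed.

Section Extension.
Variables (A B C : oagType) (psiA : A -> A) (psiB : B -> B) (psiC : C -> C).
Variables (f : A -> B) (g : A -> C).

(** Taking [V = R] makes the domain closed under [psi]. For [s] and [p] only the domain is
    constrained; that the images correspond is derived afterwards. *)
Record extension (R : B -> C -> Prop) : Prop := {
  ext_iso : partial_iso psiB psiC R R;
  ext_base : forall a, R (f a) (g a);
  ext_s : forall x y, R x y -> exists z, R (successor psiB x) z;
  ext_p : forall x y w, R x y -> Psi psiB w -> successor psiB w = x ->
            exists z, R w z
}.

End Extension.

Section SamePsi.
Variables (A B : oagType) (psiA : A -> A) (psiB : B -> B) (f : A -> B).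
Hypotheses (TA : T0_model psiA) (TB : T0_model psiB).
Hypothesis fE : couple_embedding psiA psiB f.
Let acA := T0_couple TA.
Let acB := T0_couple TB.
Let HtA := T0_Htype TA.
Let HtB := T0_Htype TB.

Lemma Psi_pos_witness v : Psi psiA v -> exists2 e, 0 < e & psiA e = v.
Proof.
move=> [e /= e0 eE]; case: (oag_ltP 0 e) => [h|h|h]; first by exists e.
  by rewrite -h eqxx in e0.
by exists (- e); rewrite ?oag_oppr_gt0 // (psiN acA).
Qed.

Definition near_alpha alpha (b a : A) : Prop :=
  [/\ f a < alpha -> a < b, alpha < f a -> b < a &
      f (psiA (b - a)) = psiB (alpha - f a)].

(** Both [alpha - f c] and [b - c] have value [v > va], so [alpha - f a] and [b - a] have the sign
    and the value of [c - a]. *)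
Lemma near_alpha_far alpha (a c b va v : A) : (forall d, alpha <> f d) ->
  f va = psiB (alpha - f a) -> f v = psiB (alpha - f c) ->
  va < v -> b != c -> psiA (b - c) = v -> near_alpha alpha b a.
Proof.
move=> alphaN vaE vE lt_v bc bcE.
have subN d : alpha - f d != 0 by rewrite subr_eq0; apply/eqP; exact: alphaN.
have [||ca_nz ca_psi ca_pos] :=
  @psi_dominant _ _ acB HtB (alpha - f a) (- (alpha - f c)) => //.
  by apply: (psigtN acB) => _; rewrite -vaE -vE (ce_ltE fE).
have ca_neg : (alpha - f a + - (alpha - f c) < 0) = (alpha - f a < 0).
  apply: (psi_dominant_lt0 acB HtB) => //.
  by apply: (psigtN acB) => _; rewrite -vaE -vE (ce_ltE fE).
have e : alpha - f a + - (alpha - f c) = f (c - a) by rewrite (ce_B fE); zring.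
rewrite e -vaE in ca_nz ca_psi ca_pos ca_neg.
rewrite (ce_neq0 fE) in ca_nz.
rewrite -(ce_psi fE) // in ca_psi; move/(ce_inj fE): ca_psi => ca_psi.
rewrite -{1}(ce_0 fE) (ce_ltE fE) !oag_subr_gt0 in ca_pos.
rewrite -{1}(ce_0 fE) (ce_ltE fE) !oag_subr_lt0 in ca_neg.
have bcv : psigt psiA (psiA (c - a)) (b - c) by move=> _; rewrite bcE ca_psi.
have [_ h1 h2] := psi_dominant acA HtA ca_nz bcv.
have h3 := psi_dominant_lt0 acA HtA ca_nz bcv.
have e2 : c - a + (b - c) = b - a by zring.
rewrite e2 in h1 h2 h3; split.
- by rewrite -ca_pos -oag_subr_gt0 -h2 oag_subr_gt0.
- by rewrite -ca_neg -oag_subr_lt0 -h3 oag_subr_lt0.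
- by rewrite h1 ca_psi.
Qed.

(** Type H gives [va <= v], and [va < v] is the far case. If [va = v], type H on [b - c <= b - a]
    bounds [psiA (b - a)] above by [v], and (AC1) on [(b - c) + (c - a)] bounds it below. *)
Lemma near_alpha_left alpha (a c b va v : A) : (forall a, alpha <> f a) ->
  f va = psiB (alpha - f a) -> f v = psiB (alpha - f c) ->
  f c < alpha -> a <= c -> c < b -> psiA (b - c) = v ->
  near_alpha alpha b a.
Proof.
move=> alphaN vaE vE ca ac cb bcE.
have subN d : alpha - f d != 0 by rewrite subr_eq0; apply/eqP; exact: alphaN.
have aal : f a < alpha.
  by apply: le_lt_trans ca; rewrite (ce_leE fE).
have va_v : va <= v.
  rewrite oag_leNgt -(ce_ltE fE) vaE vE -oag_leNgt.
  apply: HtB; first by rewrite oag_subr_gt0.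
  have := @oag_leD2l _ (alpha - f a - f c) (f a) (f c).
  rewrite (_ : _ + f a = alpha - f c); last by zring.
  rewrite (_ : _ + f c = alpha - f a); last by zring.
  by apply; rewrite (ce_leE fE).
have [lt_v|eq_v] : va < v \/ va = v.
  by rewrite le_eqVlt in va_v; case/orP: va_v => [/eqP|]; [right|left].
  by apply: (near_alpha_far alphaN vaE vE) => //; rewrite gt_eqF.
have ab : a < b by apply: le_lt_trans cb.
split=> //; first by move=> /(lt_trans aal); rewrite ltxx.
rewrite -vaE eq_v; congr f.
have ba0 : b - a != 0 by rewrite subr_eq0 gt_eqF.
apply/eqP; rewrite eq_le; apply/andP; split.
  rewrite -bcE; apply: HtA; first by rewrite oag_subr_gt0.
  have := @oag_leD2l _ (b - a - c) a c ac.
  rewrite (_ : _ + a = b - c); last by zring.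
  by rewrite (_ : _ + c = b - a); last by zring.
have -> : b - a = (b - c) + (c - a) by zring.
apply: (@psigeD _ _ acA v) => [_||]; first by rewrite bcE.
  move=> ca0; rewrite oag_leNgt -(ce_ltE fE) (ce_psi fE) // -oag_leNgt.
  have -> : f (c - a) = (alpha - f a) - (alpha - f c) by rewrite (ce_B fE); zring.
  apply: (@psigeD _ _ acB (f v)).
  - by move=> _; rewrite -vaE eq_v.
  - by apply: (psigeN acB) => _; rewrite -vE.
  - by rewrite (_ : _ + _ = f (c - a)) ?(ce_neq0 fE) // (ce_B fE); zring.
by rewrite (_ : _ + _ = b - a) //; zring.
Qed.

(** Negating all points reduces this to the left-hand case. *)
Lemma near_alpha_right alpha (a c b va v : A) : (forall a, alpha <> f a) ->
  f va = psiB (alpha - f a) -> f v = psiB (alpha - f c) ->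
  alpha < f c -> c <= a -> b < c -> psiA (b - c) = v ->
  near_alpha alpha b a.
Proof.
move=> alphaN vaE vE ca ac cb bcE.
have subN d : alpha - f d != 0 by rewrite subr_eq0; apply/eqP; exact: alphaN.
have psiS d : psiB (- alpha - f (- d)) = psiB (alpha - f d).
  by rewrite -(psiN acB (subN d)) (ce_N fE); congr psiB; zring.
have ltN (G : oagType) (x y : G) : (- x < - y) = (y < x).
  by rewrite -(oag_subr_gt0 (- x)) (_ : _ - _ = x - y) ?oag_subr_gt0 //; zring.
have [|||||||h1 h2 h3] :=
  @near_alpha_left (- alpha) (- a) (- c) (- b) va v.
- by move=> d e; apply: (alphaN (- d)); rewrite (ce_N fE) -e opprK.
- by rewrite psiS.
- by rewrite psiS.
- by rewrite (ce_N fE) ltN.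
- by rewrite oag_leNgt ltN -oag_leNgt.
- by rewrite ltN.
- rewrite -bcE -(psiN acA); first by congr psiA; zring.
  by rewrite opprK addrC subr_eq0 gt_eqF.
rewrite (ce_N fE) !ltN in h1 h2; split => //.
rewrite -psiS -h3; congr f; rewrite -(psiN acA).
  by congr psiA; zring.
rewrite subr_eq0; apply/eqP => ba; rewrite ba in h1 h2.
by case: (oag_ltP (f a) alpha) => [/h2|e|/h1]; rewrite ?ltxx //; case: (alphaN a).
Qed.

Variable alpha : B.
Hypotheses (PsiB_sub : forall x, Psi psiB x -> exists a, x = f a)
           (alphaN : forall a, alpha <> f a).

Let subN a : alpha - f a != 0.
Proof. by rewrite subr_eq0; apply/eqP; exact: alphaN. Qed.

Lemma psi_alpha a : exists2 v, Psi psiA v & f v = psiB (alpha - f a).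
Proof.
have P : Psi psiB (psiB (alpha - f a)).
  by apply: Psi_psi; rewrite subr_eq0; apply/eqP; exact: alphaN.
by have [v vE] := PsiB_sub P; exists v => //; apply/(ce_PsiE TA TB fE); rewrite -vE.
Qed.

(** [c] and [d] are the points of the list nearest to [alpha] on the left and on the right. The
    point [b] copies the value of [alpha] at the one with the larger value; the other points of the
    list follow from the one-sided and far cases. *)
Lemma near_alpha_seq (l : seq A) :
  exists b, forall a, a \in l -> near_alpha alpha b a.
Proof.
have side a : f a < alpha \/ alpha < f a.
  by case: (oag_ltP (f a) alpha); [left|move=> e; case: (alphaN (esym e))|right].
have letot : total (<=%O : rel A) by move=> x y; apply: oag_le_total.
have getot : total (>=%O : rel A) by move=> x y; apply: oag_le_total.
have getr : transitive (>=%O : rel A) by move=> x y z xy yz; apply: le_trans xy.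
have [noL|[c [cl cP cmax]]] := seq_maximum (fun a => f a < alpha) l letot le_trans;
have [noR|[d [dl dP dmin]]] := seq_maximum (fun a => alpha < f a) l getot getr.
- exists 0 => a al; exfalso.
  by case: (side a) => h; [have := noL a al|have := noR a al]; rewrite h.
- have [v Pv vE] := psi_alpha d; have [e e0 eE] := Psi_pos_witness Pv.
  exists (d - e) => a al; have [va _ vaE] := psi_alpha a.
  have h : alpha < f a by case: (side a) => // h; have := noL a al; rewrite h.
  apply: (near_alpha_right alphaN vaE vE) => //.
  + exact: dmin.
  + by rewrite -oag_subr_gt0 (_ : _ - _ = e) //; zring.
  + by rewrite (_ : d - e - d = - e) ?(psiN acA) ?gt_eqF //; zring.
- have [v Pv vE] := psi_alpha c; have [e e0 eE] := Psi_pos_witness Pv.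
  exists (c + e) => a al; have [va _ vaE] := psi_alpha a.
  have h : f a < alpha by case: (side a) => // h; have := noR a al; rewrite h.
  apply: (near_alpha_left alphaN vaE vE) => //.
  + exact: cmax.
  + by rewrite -oag_subr_gt0 (_ : _ - _ = e) //; zring.
  + by rewrite (_ : c + e - c = e) //; zring.
have [v Pv vE] := psi_alpha c; have [u Pu uE] := psi_alpha d.
case: (oag_ltP v u) => vu.
- have [e e0 eE] := Psi_pos_witness Pu.
  have bd : d - e < d by rewrite -oag_subr_gt0 (_ : _ - _ = e) //; zring.
  have bE : psiA (d - e - d) = u.
    by rewrite (_ : d - e - d = - e) ?(psiN acA) ?gt_eqF //; zring.
  exists (d - e) => a al; have [va _ vaE] := psi_alpha a.
  case: (side a) => h; last first.
    by apply: (near_alpha_right alphaN vaE uE) => //; apply: dmin.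
  apply: (near_alpha_far alphaN vaE uE) => //; last by rewrite lt_eqF.
  apply: le_lt_trans vu; rewrite oag_leNgt -(ce_ltE fE) vaE vE -oag_leNgt.
  apply: HtB; first by rewrite oag_subr_gt0.
  rewrite -[X in _ <= X](_ : alpha - f c + f (c - a) = _); last by rewrite (ce_B fE); zring.
  rewrite -{1}(addr0 (alpha - f c)) oag_leD2l // -(ce_0 fE).
  by rewrite (ce_leE fE) oag_leNgt oag_subr_lt0 -oag_leNgt; apply: cmax.
(* Equal values: neither side is nearer, and the midpoint serves. Here [psiA (d - c) = v], and both
   halves of [d - c] keep this value. *)
- subst u.
  have [b bE] := divisible_mulrz TA (c + d) (isT : 2%:Z != 0).
  have b2 : (b - c) *~ 2 = d - c by rewrite mulrzBl bE; zring.
  have b2' : (d - b) *~ 2 = d - c by rewrite mulrzBl bE; zring.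
  have cd : c < d by rewrite -(ce_ltE fE); apply: lt_trans dP.
  have dc0 : d - c != 0 by rewrite subr_eq0 gt_eqF.
  have dcv : psiA (d - c) = v.
    apply: (ce_inj fE); rewrite (ce_psi fE) //.
    have e : f (d - c) = (alpha - f c) - (alpha - f d) by rewrite (ce_B fE); zring.
    apply/eqP; rewrite eq_le; apply/andP; split.
      rewrite vE; apply: HtB; first by rewrite oag_subr_gt0.
      rewrite e -{1}(addr0 (alpha - f c)) oag_leD2l // ltW //.
      by rewrite oag_oppr_gt0 oag_subr_lt0.
    rewrite e; apply: (@psigeD _ _ acB (f v)); last by rewrite -e (ce_neq0 fE).
      by move=> _; rewrite vE.
    by apply: (psigeN acB) => _; rewrite uE.
  have bc : c < b by rewrite -oag_subr_gt0 -(@oag_pmulrz_gt0 _ (b - c) 2) // b2 oag_subr_gt0.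
  have bd : b < d by rewrite -oag_subr_gt0 -(@oag_pmulrz_gt0 _ (d - b) 2) // b2' oag_subr_gt0.
  have bcv : psiA (b - c) = v.
    rewrite -dcv; apply: (@psi_multiple _ _ acA _ _ 2 1) => //.
    by rewrite subr_eq0 gt_eqF.
  have bdv : psiA (b - d) = v.
    rewrite -dcv; apply: (@psi_multiple _ _ acA _ _ 2 (- 1)) => //.
      by rewrite mulrNz -b2'; zring.
    by rewrite subr_eq0 lt_eqF.
  exists b => a al; have [va _ vaE] := psi_alpha a.
  case: (side a) => h.
    by apply: (near_alpha_left alphaN vaE vE) => //; apply: cmax.
  by apply: (near_alpha_right alphaN vaE uE) => //; apply: dmin.
have [e e0 eE] := Psi_pos_witness Pv.
have bc : c < c + e by rewrite -oag_subr_gt0 (_ : _ - _ = e) //; zring.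
have bE : psiA (c + e - c) = v by rewrite (_ : c + e - c = e) //; zring.
exists (c + e) => a al; have [va _ vaE] := psi_alpha a.
case: (side a) => h.
  by apply: (near_alpha_left alphaN vaE vE) => //; apply: cmax.
apply: (near_alpha_far alphaN vaE vE) => //; last by rewrite gt_eqF.
apply: le_lt_trans vu; rewrite -(ce_leE fE) vaE uE.
rewrite -(psiN acB (subN a)) -(psiN acB (subN d)).
apply: HtB; first by rewrite oag_oppr_gt0 oag_subr_lt0.
rewrite -[X in _ <= X](_ : - (alpha - f d) + f (a - d) = _); last by rewrite (ce_B fE); zring.
rewrite -{1}(addr0 (- (alpha - f d))) oag_leD2l // -(ce_0 fE).
by rewrite (ce_leE fE) oag_leNgt oag_subr_lt0 -oag_leNgt; apply: dmin.
Qed.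

(** Values of [s], and the [w] in [Psi psiB], all lie in the image of [f], so closure under [s] and
    [p] comes for free. *)
Lemma same_psi_extension (C : oagType) (psiC : C -> C) (g : A -> C) (beta : C) :
  T0_model psiC -> couple_embedding psiA psiC g ->
  (forall a v, f v = psiB (alpha - f a) ->
     [/\ f a < alpha -> g a < beta, alpha < f a -> beta < g a &
         psiC (beta - g a) = g v]) ->
  extension psiB psiC f g (adjoin (base_rel f g) alpha beta).
Proof.
move=> TC gE betaP; have I := base_iso TA fE gE.
have base_sub a : adjoin (base_rel f g) alpha beta (f a) (g a).
  by apply: (adjoin_sub _ _ (pi_linear I)); exists a.
have Psi_sub x : Psi psiB x -> exists z, adjoin (base_rel f g) alpha beta x z.
  by move=> /PsiB_sub[a ->]; exists (g a).
split=> //.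
- apply: (adjoin_iso TB TC I) => [_ _ [a [_ -> ->]] //|_ _ [a [-> ->]]].
  have [v _ vE] := psi_alpha a; have [h1 h2 h3] := betaP _ _ vE.
  by split=> //; [apply/eqP; exact: alphaN|rewrite -vE h3].
- by move=> x _ _; apply/Psi_sub/Psi_s.
- by move=> _ _ w _ Pw _; apply: Psi_sub.
Qed.

End SamePsi.

(** * Extensions by a new value of psi *)

Section Cut.
Variables (A B : oagType) (psiA : A -> A) (psiB : B -> B) (f : A -> B).
Hypotheses (TA : T0_model psiA) (TB : T0_model psiB).
Hypothesis fE : couple_embedding psiA psiB f.
Local Notation s := (successor psiB).
Variable D : A -> Prop.

(** [D] is the lower part of the cut, given on [A] so that the same cut can be read in [B] through
    [f] and in [C] through [g]. *)
Definition in_cut (x : B) : Prop :=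
  [/\ Psi psiB x, forall a, x <> f a & forall a, Psi psiA a -> (D a <-> f a < x)].

(** No element of [Psi psiB] lies strictly between [x] and [s x], so the cut is unchanged. If [s x]
    were some [f a], then [a = s b] with [b] in [Psi psiA], and injectivity would give [x = f b]. *)
Lemma in_cut_s x : in_cut x -> in_cut (s x).
Proof.
move=> [Px xN Dx]; split; first exact: Psi_s.
  move=> a sxa; have Pa : Psi psiA a.
    by apply/(ce_PsiE TA TB fE); rewrite -sxa; apply: Psi_s.
  case: (Psi_cases TA Pa) => [a0|[b Pb ba]].
    by have := s0_lt_s TB Px; rewrite sxa a0 (ce_s TA TB fE) (ce_0 fE) ltxx.
  apply: (xN b); apply: (Psi_s_inj TB) => //; first by apply/(ce_PsiE TA TB fE).
  by rewrite -(ce_s TA TB fE) ba.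
move=> a Pa; rewrite Dx //; split=> [ax|ax].
  exact: lt_trans ax (Psi_lt_s TB Px).
case: (oag_ltP (f a) x) => // [e|xa]; first by case: (xN a).
have Pfa : Psi psiB (f a) by apply/(ce_PsiE TA TB fE).
by have := Psi_s_le TB Px Pfa xa; rewrite oag_leNgt ax.
Qed.

(** [x] has a predecessor because [s 0] is in the image of [f] and [x] is not. *)
Lemma in_cut_pred x : in_cut x -> in_cut (predecessor psiB x) /\
  s (predecessor psiB x) = x.
Proof.
move=> [Px xN Dx]; have x0 : Psi_gt_s0 psiB x.
  split=> //; case: (Psi_cases TB Px) => [x0|[y Py <-]]; last exact: s0_lt_s.
  by case: (xN (successor psiA 0)); rewrite (ce_s TA TB fE) (ce_0 fE).
have [Py yx] := predecessorE TB x0; move: (predecessor psiB x) Py yx => y Py yx.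
split=> //; split=> // a.
  by move=> ya; apply: (xN (successor psiA a)); rewrite (ce_s TA TB fE) -ya.
move=> Pa; have Pfa : Psi psiB (f a) by apply/(ce_PsiE TA TB fE).
rewrite Dx //; split=> [ax|ay]; last by rewrite -yx; apply: (lt_trans ay); apply: Psi_lt_s.
case: (oag_ltP (f a) y) => // [e|ya].
  by case: (xN (successor psiA a)); rewrite (ce_s TA TB fE) e.
by have := Psi_s_le TB Py Pfa ya; rewrite yx oag_leNgt ax.
Qed.

Lemma chain_exists x : in_cut x ->
  exists c : int -> B, [/\ c 0 = x, forall k, in_cut (c k) & forall k, s (c k) = c (k + 1)].
Proof.
move=> xP.
pose c (k : int) := match k with
  | Posz n => iter n s x | Negz n => iter n.+1 (predecessor psiB) x end.
have up n : in_cut (iter n s x) by elim: n => // n IH; apply: in_cut_s.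
have dn n : in_cut (iter n (predecessor psiB) x).
  by elim: n => // n IH; apply: (in_cut_pred IH).1.
exists c; split=> // -[n|n]; rewrite /c //.
- by rewrite (_ : Posz n + 1 = Posz n.+1) //; lia.
- case: n => [|n]; first by rewrite (in_cut_pred (dn 0%N)).2.
  rewrite (_ : Negz n.+1 + 1 = Negz n); last by lia.
  by rewrite [in LHS]/= (in_cut_pred (dn n.+1)).2.
Qed.

Lemma chain_lt (c : int -> B) : (forall k, in_cut (c k)) ->
  (forall k, s (c k) = c (k + 1)) -> forall j k : int, j < k -> c j < c k.
Proof.
move=> cP cs j k jk; have [n ->] : exists n : nat, k = j + n.+1%:Z.
  by exists (absz (k - j - 1)%R); lia.
elim: n => [|n IH]; first by rewrite -cs; apply: Psi_lt_s TB _ _; case: (cP j).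
apply: (lt_trans IH); rewrite (_ : j + n.+2%:Z = (j + n.+1%:Z) + 1); last by lia.
by rewrite -cs; apply: Psi_lt_s TB _ _; case: (cP (j + n.+1%:Z)).
Qed.

(** As [s (c (k - 1)) = c k < s (c k)], the difference has the lesser successor [c k] as its
    value. *)
Lemma chain_diff (c : int -> B) : (forall k, in_cut (c k)) ->
  (forall k, s (c k) = c (k + 1)) ->
  forall k, c (k - 1) - c k < 0 /\ psiB (c (k - 1) - c k) = c k.
Proof.
move=> cP cs k; have ck : c (k - 1) < c k by apply: chain_lt => //; lia.
split; first by rewrite oag_subr_lt0.
have sk : s (c (k - 1)) = c k by rewrite cs; congr c; lia.
have lt_s : s (c (k - 1)) < s (c k) by rewrite sk cs; apply: chain_lt => //; lia.
rewrite -(psiN (T0_couple TB)) ?subr_eq0 ?(lt_eqF ck) //.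
by rewrite opprB (s_lt_psiB TB lt_s).1.
Qed.

End Cut.

(** * The divisible group generated by [A] and the chain, with its image in [C] *)

Section NewPsi.
Variables (A B C : oagType) (psiA : A -> A) (psiB : B -> B) (psiC : C -> C).
Variables (f : A -> B) (g : A -> C).
Hypotheses (TA : T0_model psiA) (TB : T0_model psiB) (TC : T0_model psiC).
Hypotheses (fE : couple_embedding psiA psiB f) (gE : couple_embedding psiA psiC g).
Variables (D : A -> Prop) (c : int -> B) (d : int -> C).
Hypotheses (cP : forall k, in_cut psiA psiB f D (c k))
           (dP : forall k, in_cut psiA psiC g D (d k))
           (cs : forall k, successor psiB (c k) = c (k + 1))
           (ds : forall k, successor psiC (d k) = d (k + 1)).
Let acB := T0_couple TB.
Let acC := T0_couple TC.
Let HtB := T0_Htype TB.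
Let HtC := T0_Htype TC.
Local Notation sB := (successor psiB).
Local Notation sC := (successor psiC).
Local Notation sA := (successor psiA).

Let c_lt j k : j < k -> c j < c k.
Proof. exact: (chain_lt TB cP cs). Qed.

Let d_lt j k : j < k -> d j < d k.
Proof. exact: (chain_lt TC dP ds). Qed.

(** A range for the values of [psi] once the chain is adjoined down to [c m]. The value [c m] itself
    only appears with the next generator, [c (m - 1) - c m]. *)
Definition chain_val (m : int) (u : B) (v : C) : Prop :=
  base_Psi psiA f g u v \/ exists k, [/\ m < k, u = c k & v = d k].

Lemma chain_val_weaken m n u v : n <= m -> chain_val m u v -> chain_val n u v.
Proof.
by move=> nm [h|[k [mk -> ->]]]; [left|right; exists k; split=> //; apply: le_lt_trans mk].
Qed.

Lemma base_Psi_lt u v k : base_Psi psiA f g u v ->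
  [/\ u != c k, u < c k -> v < d k & c k < u -> d k < v].
Proof.
case=> a [Pa -> ->]; have [_ cN cD] := cP k; have [_ dN dD] := dP k.
split.
- by apply/eqP => e; apply: (cN a).
- by move/(cD _ Pa)/(dD _ Pa).
- move=> h; case: (oag_ltP (d k) (g a)) => // [/dN//|/(dD _ Pa)/(cD _ Pa)].
  by move/(lt_trans h); rewrite ltxx.
Qed.

Lemma chain_val_lt m u v k : k <= m -> chain_val m u v ->
  [/\ u != c k, u < c k -> v < d k & c k < u -> d k < v].
Proof.
move=> km [/base_Psi_lt//|[j [mj -> ->]]].
have kj : k < j by apply: le_lt_trans mj.
split; first by rewrite gt_eqF // c_lt.
  by move/(lt_trans (c_lt kj)); rewrite ltxx.
by move=> _; apply: d_lt.
Qed.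

(* The generators are differences because psi (c (j - 1) - c j) = c j: each one
   has a value of psi which is not taken before it is added. *)
Fixpoint chain_rel (m : int) (k : nat) : B -> C -> Prop :=
  if k is k'.+1 then
    adjoin (chain_rel m k') (c (m - k'%:Z - 1) - c (m - k'%:Z))
                            (d (m - k'%:Z - 1) - d (m - k'%:Z))
  else adjoin (base_rel f g) (c m) (d m).

(** The value of [c m - f a] is the lesser of [s (f a)] and [s (c m) = c (m + 1)]; these differ
    because the former is in the image of [f]. The sign follows from comparing [f a] with [s (f a)]
    in one case, [c m] with [s (c m)] in the other. *)
Lemma chain_rel0_iso m : partial_iso psiB psiC (chain_rel m 0) (chain_val m).
Proof.
apply: (adjoin_iso TB TC (base_iso TA fE gE)) => [u v h|_ _ [a [-> ->]]]; first by left.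
have cN : c m - f a != 0 by rewrite subr_eq0; apply/eqP; case: (cP m).
have dN : d m - g a != 0 by rewrite subr_eq0; apply/eqP; case: (dP m).
have sa : base_Psi psiA f g (sB (f a)) (sC (g a)).
  exists (sA a); rewrite (ce_s TA TB fE) (ce_s TA TC gE); split=> //; exact: Psi_s.
have [ne lt_ gt_] := base_Psi_lt (m + 1) sa.
rewrite -cs -ds in ne lt_ gt_.
case: (oag_ltP (sB (f a)) (sB (c m))) => h; last 1 first.
- have [ch cpos] := s_lt_psiB TB h; have [dh dpos] := s_lt_psiB TC (gt_ h).
  have caf : c m < f a.
    by rewrite -oag_subr_gt0 cpos cs; apply: c_lt; (clear; lia).
  have dag : d m < g a.
    by rewrite -oag_subr_gt0 dpos ds; apply: d_lt; (clear; lia).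
  split=> //; first by rewrite lt_eqF.
    by move/(lt_trans caf); rewrite ltxx.
  right; exists (m + 1); split; first by (clear; lia).
    by rewrite -(psiN acB cN) opprB ch cs.
  by rewrite -(psiN acC dN) opprB dh ds.
- have [ch cpos] := s_lt_psiB TB h; have [dh dpos] := s_lt_psiB TC (lt_ h).
  rewrite oag_subr_gt0 -(ce_s TA TB fE) (ce_ltE fE) in cpos.
  rewrite oag_subr_gt0 -(ce_s TA TC gE) (ce_ltE gE) in dpos.
  split; first by rewrite -subr_eq0.
  + by rewrite cpos dpos.
  + move=> caf; case: (oag_ltP (d m) (g a)) => // [e|].
      by rewrite e subrr eqxx in dN.
    by rewrite dpos -cpos => /(lt_trans caf); rewrite ltxx.
  + by left; rewrite ch dh.
- by rewrite h eqxx in ne.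
Qed.

(** The new generator [e] is negative and its value [c j] is taken by no earlier point. So [e] or
    [- x] dominates [e - x], according to the place of [psiB x] relative to [c j]; by [chain_val_lt]
    the place is the same in [C]. *)
Lemma chain_rel_iso m k :
  partial_iso psiB psiC (chain_rel m k) (chain_val (m - k%:Z)).
Proof.
elim: k => [|k IH]; first by rewrite subr0; apply: chain_rel0_iso.
have -> : m - k.+1%:Z = m - k%:Z - 1 by (clear; lia).
rewrite [chain_rel _ _]/=; move: (m - k%:Z) IH => j IH.
have [c0 cpsi] := chain_diff TB cP cs j.
have [d0 dpsi] := chain_diff TC dP ds j.
move: (c (j - 1) - c j) (d (j - 1) - d j) c0 d0 cpsi dpsi => e e' e0 e'0 eE e'E.
have en : e != 0 by rewrite lt_eqF.
have e'n : e' != 0 by rewrite lt_eqF.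
apply: (adjoin_iso TB TC IH) => [u v|x y xy].
  by apply: chain_val_weaken; (clear; lia).
have ej : chain_val (j - 1) (psiB e) (psiC e').
  by right; exists j; split=> //; (clear; lia).
have [x0|x0] := eqVneq x 0.
  rewrite x0 in xy *; rewrite (pi_zero IH xy) !subr0; split=> //.
  by move/(lt_trans e0); rewrite ltxx.
have y0 := pi_neq0 IH xy x0.
have v := pi_psi IH xy x0; have [ne lt_ gt_] := chain_val_lt (lexx j) v.
case: (oag_ltP (psiB x) (c j)) => h.
- have [||h1 h2 h3] := @psi_dominant _ _ acB HtB (- x) e.
    by rewrite oppr_eq0.
    by rewrite (psiN acB) // => _; rewrite eE.
  have [||h1' h2' h3'] := @psi_dominant _ _ acC HtC (- y) e'.
    by rewrite oppr_eq0.
    by rewrite (psiN acC) // => _; rewrite e'E; apply: lt_.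
  rewrite addrC in h1 h2 h3; rewrite addrC in h1' h2' h3'.
  rewrite oag_subr_gt0 oag_oppr_gt0 in h3; rewrite oag_subr_gt0 oag_oppr_gt0 in h3'.
  split; first by rewrite -subr_eq0.
  + by rewrite h3 h3'; apply: (pi_neg IH).
  + move=> ex; case: (oag_ltP e' y) => // [e'y|].
      by rewrite e'y subrr eqxx in h1'.
    rewrite h3' => /lt_trans h4; have xpos : 0 < x.
      case: (oag_ltP 0 x) => // [x00|]; first by rewrite x00 eqxx in x0.
      by rewrite -h3 => /(lt_trans ex); rewrite ltxx.
    by have := h4 _ (pi_pos IH xy xpos); rewrite ltxx.
  + rewrite h2 h2' (psiN acB) // (psiN acC) //.
    by apply: chain_val_weaken v; (clear; lia).
- by rewrite h eqxx in ne.
- have [||h1 h2 h3] := @psi_dominant _ _ acB HtB e (- x) => //.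
    by apply: (psigtN acB) => _; rewrite eE.
  have [||h1' h2' h3'] := @psi_dominant _ _ acC HtC e' (- y) => //.
    by apply: (psigtN acC) => _; rewrite e'E; apply: gt_.
  have ex : e < x.
    rewrite -oag_subr_lt0 (psi_dominant_lt0 acB HtB) //.
    by apply: (psigtN acB) => _; rewrite eE.
  have e'y : e' < y.
    rewrite -oag_subr_lt0 (psi_dominant_lt0 acC HtC) //.
    by apply: (psigtN acC) => _; rewrite e'E; apply: gt_.
  split=> //; first by rewrite lt_eqF.
    by move/(lt_trans ex); rewrite ltxx.
  by rewrite h2 h2'.
Qed.

Let chain_rel_lin m k : linear_rel (chain_rel m k).
Proof. exact: pi_linear (chain_rel_iso m k). Qed.

Lemma chain_rel_le m j k x y : (j <= k)%N -> chain_rel m j x y -> chain_rel m k x y.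
Proof.
move=> /subnKC <-; elim: (k - j)%N => [|i IH] xy; first by rewrite addn0.
by rewrite addnS; apply: adjoin_sub => //; apply: IH.
Qed.

Lemma chain_rel_mem m k : chain_rel m k (c (m - k%:Z)) (d (m - k%:Z)).
Proof.
elim: k => [|k IH].
  by rewrite subr0; apply: adjoin_gen; apply: pi_linear (base_iso TA fE gE).
have -> : m - k.+1%:Z = m - k%:Z - 1 by (clear; lia).
have := lr_D (chain_rel_lin m k.+1) (adjoin_gen _ _ (chain_rel_lin m k))
  (chain_rel_le (leqnSn k) IH).
by congr (chain_rel _ _ _ _); zring.
Qed.

(** Each generator on the left is a generator on the right, except [c m], which is a sum of two.
    This makes the stages of [chain_ext] increase. *)
Lemma chain_rel_up m k x y : chain_rel m k x y -> chain_rel (m + 1) k.+1 x y.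
Proof.
elim: k x y => [|k IH] x y.
  apply: adjoin_min => //.
    move=> u v uv; apply: (chain_rel_le (leq0n 1)); rewrite [chain_rel _ _]/=.
    by apply: adjoin_sub uv; apply: pi_linear (base_iso TA fE gE).
  by have := chain_rel_mem (m + 1) 1; rewrite addrK.
apply: adjoin_min => // [u v /IH|]; first by apply: chain_rel_le.
have -> : m - k%:Z = m + 1 - k.+1%:Z by clear; lia.
apply: (adjoin_gen _ _ (chain_rel_lin (m + 1) k.+1)).
Qed.

(** Stage [n] is the divisible hull of [A] and the [c k] with [- n <= k <= n], so the union exhausts
    the chain in both directions. *)
Definition chain_ext (x : B) (y : C) : Prop :=
  exists n : nat, chain_rel n%:Z (n + n) x y.

Lemma chain_ext_le (m n : nat) x y : (m <= n)%N ->
  chain_rel m%:Z (m + m) x y -> chain_rel n%:Z (n + n) x y.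
Proof.
move=> /subnKC <-; elim: (n - m)%N => [|i IH] xy; first by rewrite addn0.
have -> : (m + i.+1)%N%:Z = (m + i)%N%:Z + 1 by (clear; lia).
have -> : (m + i.+1 + (m + i.+1))%N = (m + i + (m + i)).+2 by (clear; lia).
by apply: (chain_rel_le (leqnSn _)); apply: chain_rel_up; apply: IH.
Qed.

Lemma chain_ext_c k : chain_ext (c k) (d k).
Proof.
pose j := absz ((absz k)%:Z - k)%R.
have kE : (absz k)%:Z - j%:Z = k by rewrite /j; clear; lia.
have := chain_rel_mem (absz k)%:Z j; rewrite kE => xy; exists (absz k).
by apply: chain_rel_le xy; rewrite /j; clear; lia.
Qed.

Lemma chain_ext_base a : chain_ext (f a) (g a).
Proof.
exists 0%N; apply: adjoin_sub; first exact: pi_linear (base_iso TA fE gE).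
by exists a.
Qed.

Lemma chain_ext_val m u v : chain_val m u v -> chain_ext u v.
Proof.
case=> [[a [_ -> ->]]|[k [_ -> ->]]]; first exact: chain_ext_base.
exact: chain_ext_c.
Qed.

Lemma chain_ext_iso : partial_iso psiB psiC chain_ext chain_ext.
Proof.
split; first split.
- by exists 0%N; apply: lr_0.
- move=> x y x' y' [m xy] [n xy']; exists (m + n)%N; apply: lr_D => //.
    exact: chain_ext_le (leq_addr _ _) xy.
  exact: chain_ext_le (leq_addl _ _) xy'.
- by move=> x y [n xy]; exists n; apply: lr_N.
- by move=> x y k k0 [n xy]; exists n; apply: lr_div xy.
- by move=> y [n]; apply: pi_zero (chain_rel_iso _ _) _.
- by move=> x y [n]; apply: pi_pos (chain_rel_iso _ _) _ _.
- by move=> x y [n /(pi_psi (chain_rel_iso _ _)) xy] /xy/chain_ext_val.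
Qed.

(** By hypothesis [psiB (x - c m) = s (c m) = c (m + 1)]. Each chain generator is shown not to occur
    in [x], since it would contradict this value or the hypothesis; the last one added is treated
    first. *)
Lemma chain_rel_far m k x y : chain_rel m k x y ->
  (forall j, c j < sB x) -> exists a, x = f a.
Proof.
move=> xy far; have xc : sB (c m) < sB x by rewrite cs.
have cm0 : x - c m != 0 by apply: contraTneq xc => /subr0_eq ->; rewrite ltxx.
have cmE : psiB (x - c m) = c (m + 1) by rewrite (s_lt_psiB TB xc).1 cs.
have cut_mN a : c (m + 1) <> f a by case: (cP (m + 1)).
elim: k xy => [|k IH] [n [p [n0 r]]]; last first.
  have [p0|p0] := eqVneq p 0.
    apply: IH; apply: (lr_div (chain_rel_lin m k) n0).
    by move: r; rewrite p0 !mulr0z !subr0.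
  (* [(x - c m) *~ n] is [e *~ p] plus a point [u] of the previous stage. Their values differ, so
     the sum has value at most [psiB e = c (m - k)], which is below [c (m + 1)]. *)
  have := chain_rel_le (leq0n k) (chain_rel_mem m 0); rewrite subr0 => cm.
  have := lr_B (chain_rel_lin m k) r (lr_Mz n (chain_rel_lin m k) cm).
  have [e0 eE] := chain_diff TB cP cs (m - k%:Z).
  move: (c (m - k%:Z - 1) - c (m - k%:Z)) e0 eE r => e e0 eE r r'.
  have en : e != 0 by rewrite lt_eqF.
  have ep : e *~ p != 0 by apply: contra_neq en; apply: oag_mulrz_eq0.
  set u := (X in chain_rel m k X _) in r'.
  have [|_ le] := @psiD_le _ _ acB HtB (e *~ p) u ep.
    move=> u0; rewrite (psiMz acB) // eE.
    by have [] := chain_val_lt (lexx _) (pi_psi (chain_rel_iso m k) r' u0).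
  have xE : e *~ p + u = (x - c m) *~ n by rewrite /u; zring.
  rewrite xE (psiMz acB) // (psiMz acB) // cmE eE in le.
  have lt_m : m - k%:Z < m + 1 by clear; lia.
  by have := lt_le_trans (c_lt lt_m) le; rewrite ltxx.
have [b [xE _]] := r.
have [p0|p0] := eqVneq p 0.
  have [a aE] := divisible_mulrz TA b n0; exists a.
  apply: (oag_mulrz_inj n0); rewrite -(ce_Mz fE) aE -xE p0.
  by rewrite mulr0z subr0.
(* Now [x *~ n] is [c m *~ p] plus a point of the image of [f]. If [p = n], then [x - c m], and with
   it its value [c (m + 1)], is in that image. *)
exfalso; have [pn|pn] := eqVneq n p.
  have [a aE] := divisible_mulrz TA b n0.
  have ca : x - c m = f a.
    by apply: (oag_mulrz_inj n0); rewrite -(ce_Mz fE) aE -xE pn; zring.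
  apply: (cut_mN (psiA a)); rewrite -cmE ca (ce_psi fE) //.
  by rewrite -(ce_neq0 fE) -ca.
have np : n - p != 0 by rewrite subr_eq0.
(* [w] is chosen so that [x - c m] and [x - f w] are both rational multiples of [c m - f w]. *)
have [w wE] := divisible_mulrz TA b np.
have fbE : x *~ n = c m *~ p + f w *~ (n - p).
  by rewrite -(ce_Mz fE) wE -xE; zring.
have wcE : psiB (c m - f w) = c (m + 1).
  rewrite -cmE; apply/esym; apply: (@psi_multiple _ _ acB _ _ n (p - n)) => //.
    by rewrite subr_eq0 eq_sym.
  by rewrite mulrzBl fbE; zring.
have cw0 : c m - f w != 0 by rewrite subr_eq0; apply/eqP; case: (cP m).
have sw : sB (f w) = f (sA w) by rewrite (ce_s TA TB fE).
case: (oag_ltP (sB (f w)) (c (m + 1))) => h.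
- have lt_s : sB (f w) < sB (c m) by rewrite cs.
  by apply: (cut_mN (sA w)); rewrite -sw -(s_lt_psiB TB lt_s).1.
- by apply: (cut_mN (sA w)); rewrite -sw.
(* Here [s x] and [s (f w)] both exceed [c (m + 1)], so the value of [x - f w] does too, although it
   equals that of [c m - f w]. *)
- have xw : (x - f w) *~ n = (c m - f w) *~ p by rewrite mulrzBl fbE; zring.
  have xw0 : x - f w != 0.
    apply: contra_neq cw0 => e; apply: (oag_mulrz_eq0 p0).
    by rewrite -xw e mul0rz.
  have := s_gt_psigt TB (far (m + 1)) h xw0.
  by rewrite (psi_multiple acB n0 p0 xw xw0) wcE ltxx.
Qed.

(** If [s x < c j = s (c (j - 1))], then [s x] is the value of [c (j - 1) - x]. Otherwise [s x] is
    some [c j] or lies above the whole chain, which puts [x] in the image of [f]. *)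
Lemma chain_ext_s_val x y : chain_ext x y -> exists m z, chain_val m (sB x) z.
Proof.
move=> xy; apply: contrapT => no.
have val u v : chain_ext u v -> u != 0 -> exists m z, chain_val m (psiB u) z.
  by move=> [n /(pi_psi (chain_rel_iso _ _)) uv] /uv; exists (n%:Z - (n + n)%N%:Z), (psiC v).
have far j : c j < sB x.
  have cj : sB (c (j - 1)) = c j by rewrite cs subrK.
  case: (oag_ltP (c j) (sB x)) => // h; case: no.
    by rewrite -h; exists (j - 1), (d j); right; exists j; split=> //; (clear; lia).
  rewrite -cj in h; have [hE _] := s_lt_psiB TB h; rewrite -hE.
  apply: (val _ (d (j - 1) - y)).
    apply: (lr_B chain_ext_iso) => //; exact: chain_ext_c.
  by apply: contraTneq h => /subr0_eq ->; rewrite ltxx.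
have [n xyn] := xy; have [a xa] := chain_rel_far xyn far.
apply: no; exists 0, (g (sA a)); left; exists (sA a).
by rewrite xa (ce_s TA TB fE); split=> //; apply: Psi_s.
Qed.

Lemma Psi_chain_val m x z : Psi psiB x -> chain_val m (sB x) z ->
  exists n z', chain_val n x z'.
Proof.
move=> Px [[a [Pa sxa _]]|[k [_ sxk _]]].
  case: (Psi_cases TA Pa) => [a0|[b Pb ba]].
    by have := s0_lt_s TB Px; rewrite sxa a0 (ce_s TA TB fE) (ce_0 fE) ltxx.
  exists 0, (g b); left; exists b; split=> //.
  apply: (Psi_s_inj TB) => //; first by apply/(ce_PsiE TA TB fE).
  by rewrite sxa -ba (ce_s TA TB fE).
exists (k - 2), (d (k - 1)); right; exists (k - 1); split=> //; first by (clear; lia).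
apply: (Psi_s_inj TB) => //; first by case: (cP (k - 1)).
by rewrite sxk cs subrK.
Qed.

Lemma new_Psi_extension : extension psiB psiC f g chain_ext.
Proof.
split.
- exact: chain_ext_iso.
- exact: chain_ext_base.
- by move=> x y /chain_ext_s_val[m [z /chain_ext_val xz]]; exists z.
- move=> x y w xy Pw wx; have [m [z xz]] := chain_ext_s_val xy.
  have Px : Psi psiB x by rewrite -wx; apply: Psi_s.
  (* Two steps down: from [s x] to [x = s w], then to [w]. *)
  have [n [z1]] := Psi_chain_val Px xz; rewrite -wx => wz.
  have [n' [z2 /chain_ext_val wz2]] := Psi_chain_val Pw wz.
  by exists z2.
Qed.

End NewPsi.

(** * From couples to L-structures *)

Section ExtensionTheory.
Variables (A B C : oagType) (psiB : B -> B) (psiC : C -> C).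
Variables (f : A -> B) (g : A -> C).
Hypotheses (TB : T0_model psiB) (TC : T0_model psiC).
Variable R : B -> C -> Prop.
Hypothesis E : extension psiB psiC f g R.
Let P := ext_iso E.
Let L := pi_linear P.
Local Notation sB := (successor psiB).
Local Notation sC := (successor psiC).

Lemma ext_fun x y y' : R x y -> R x y' -> y = y'.
Proof.
move=> xy xy'; apply/subr0_eq/(pi_zero P).
by rewrite -(subrr x); apply: lr_B.
Qed.

Lemma ext_inj x x' y : R x y -> R x' y -> x = x'.
Proof.
move=> xy xy'; apply/eqP; rewrite -subr_eq0; apply/negPn/negP => x0.
have := pi_neq0 P (lr_B L xy xy') x0; by rewrite subrr eqxx.
Qed.

Lemma ext_lt x y x' y' : R x y -> R x' y' -> (x < x') = (y < y').
Proof.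
move=> xy xy'; have d := lr_B L xy' xy.
rewrite -(oag_subr_gt0 x) -(oag_subr_gt0 y); apply/idP/idP; first exact: (pi_pos P).
case: (oag_ltP 0 (x' - x)) => // [e|h].
  by rewrite -e in d; rewrite (pi_zero P d) ltxx.
by move/lt_trans/(_ (pi_neg P d h)); rewrite ltxx.
Qed.

(** If [z] is the partner of [s x], then [psiC (y - z)] is the partner of [psiB (x - s x) = s x],
    hence equals [z]; this characterizes [s y]. *)
Lemma ext_successor x y : R x y -> R (sB x) (sC y).
Proof.
move=> xy; have [z xz] := ext_s E xy; have d := lr_B L xy xz.
have [x0 xE] := integralE TB x.
have yz : R (sB x) (psiC (y - z)) by rewrite -{1}xE; apply: (pi_psi P).
rewrite (@s_unique _ _ TC y z) //; first exact: (pi_neq0 P d).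
exact: ext_fun yz xz.
Qed.

Lemma ext_s0 : R (sB 0) (sC 0).
Proof. exact/ext_successor/(lr_0 L). Qed.

(** An [e] with [psiB e = x] may lie outside the domain. Instead, [x] is [s 0] or [s w] with [w] in
    the domain, and [s] is respected. *)
Lemma ext_Psi x y : R x y -> Psi psiB x -> Psi psiC y.
Proof.
move=> xy Px; case: (Psi_cases TB Px) => [x0|[w Pw wx]].
  rewrite x0 in xy; rewrite (ext_fun xy ext_s0); exact: Psi_s.
have [z wz] := ext_p E xy Pw wx; move: xy; rewrite -wx => xy.
by rewrite (ext_fun xy (ext_successor wz)); apply: Psi_s.
Qed.

Lemma ext_predecessor x y : R x y -> Psi_gt_s0 psiB x ->
  Psi_gt_s0 psiC y /\ R (predecessor psiB x) (predecessor psiC y).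
Proof.
move=> xy xs; have [Px x0] := xs; have [Pw wx] := predecessorE TB xs.
have [z wz] := ext_p E xy Pw wx.
have ys : Psi_gt_s0 psiC y.
  by split; [exact: ext_Psi xy _|rewrite -(ext_lt ext_s0 xy)].
split=> //; have [Pq qy] := predecessorE TC ys.
suff -> : predecessor psiC y = z by [].
apply: (Psi_s_inj TC) => //; first exact: ext_Psi wz _.
rewrite qy; apply: ext_fun xy _.
by rewrite -wx; apply: ext_successor.
Qed.

(** For the converse, [s x] is always in [Psi psiB], and its predecessor is related to the
    predecessor of [s y], which is [y]. By injectivity the predecessor of [s x] is [x]. *)
Lemma ext_Psi_gt_s0 x y : R x y -> Psi_gt_s0 psiB x <-> Psi_gt_s0 psiC y.
Proof.
move=> xy; split=> [/(ext_predecessor xy)[]//|[Py y0]].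
have xy1 := ext_successor xy.
have xs : Psi_gt_s0 psiB (sB x).
  by split; [exact: Psi_s|rewrite (ext_lt ext_s0 xy1); apply: s0_lt_s].
have [ys pp] := ext_predecessor xy1 xs.
have [Pq qy] := predecessorE TC ys; have [Pp _] := predecessorE TB xs.
rewrite (Psi_s_inj TC Pq Py qy) in pp.
by split; [rewrite -(ext_inj pp xy)|rewrite (ext_lt ext_s0 xy)].
Qed.

Definition option_rel (x : Lstructure_of psiB) (y : Lstructure_of psiC) : Prop :=
  match x, y with
  | Some b, Some c => R b c
  | None, None => True
  | _, _ => False
  end.

Lemma option_rel_fun x y y' : option_rel x y -> option_rel x y' -> y = y'.
Proof. by case: x y y' => [x|] [y|] [y'|] //= xy xy'; rewrite (ext_fun xy xy'). Qed.

Lemma option_rel_inj x x' y : option_rel x y -> option_rel x' y -> x = x'.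
Proof. by case: x x' y => [x|] [x'|] [y|] //= xy xy'; rewrite (ext_inj xy xy'). Qed.

Lemma option_rel_add x y x' y' : option_rel x y -> option_rel x' y' ->
  option_rel (Ladd x x') (Ladd y y').
Proof. by case: x x' y y' => [x|] [x'|] [y|] [y'|] //=; apply: lr_D. Qed.

Lemma option_rel_opp x y : option_rel x y -> option_rel (Lopp x) (Lopp y).
Proof. by case: x y => [x|] [y|] //=; apply: lr_N. Qed.

Lemma option_rel_lt x y x' y' : option_rel x y -> option_rel x' y' ->
  (Llt x x' <-> Llt y y').
Proof.
by case: x x' y y' => [x|] [x'|] [y|] [y'|] //= xy xy'; rewrite (ext_lt xy xy').
Qed.

Lemma option_rel_psi x y : option_rel x y -> option_rel (Lpsi x) (Lpsi y).
Proof.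
case: x y => [x|] [y|] //= xy; have [x0|x0] := eqVneq x 0.
  by rewrite x0 in xy; rewrite (pi_zero P xy) eqxx.
by rewrite (negPf (pi_neq0 P xy x0)); apply: (pi_psi P).
Qed.

Lemma option_rel_s x y : option_rel x y -> option_rel (Ls x) (Ls y).
Proof. by case: x y => [x|] [y|] //= /ext_successor. Qed.

Lemma option_rel_p x y : option_rel x y -> option_rel (Lp x) (Lp y).
Proof.
case: x y => [x|] [y|] //= xy; have e := ext_Psi_gt_s0 xy.
case: asboolP => [xs|xs]; case: asboolP => [ys|ys] //=.
- by have [] := ext_predecessor xy xs.
- by case: ys; apply/e.
- by case: xs; apply/e.
Qed.

Lemma divn_byE (G : oagType) (psi : G -> G) (T : T0_model psi) n (a : G) :
  divn_by n.+1 a *+ n.+1 = a.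
Proof.
have [b ba] := T0_divisible T a (ltn0Sn n).
by apply: (@xgetPex _ 0 [set b | b *+ n.+1 = a]); exists b.
Qed.

Lemma option_rel_delta n x y : option_rel x y -> option_rel (Ldelta n x) (Ldelta n y).
Proof.
case: x y => [x|] [y|] //= xy; apply: (@lr_div _ _ _ L _ _ n.+1%:Z) => //.
by rewrite -!pmulrn (divn_byE TB) (divn_byE TC).
Qed.

End ExtensionTheory.

Lemma sval_injective (T : Type) (S : T -> Prop) : injective (@proj1_sig T S).
Proof. by move=> [x p] [y q] /= xy; subst y; rewrite (Prop_irrelevance p q). Qed.

Lemma induced_embedding (M : Lstructure) (S : substructure M) :
  embedding (fun x : induced S => proj1_sig x).
Proof. by split=> //; exact: sval_injective. Qed.

(** By injectivity only infinity goes to infinity, so [e] restricts to a map between the groups. *)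
Lemma embedding_couple (M N : Lstructure) (e : M -> N) (A B : oagType)
    (psiA : A -> A) (psiB : B -> B)
    (h : M -> Lstructure_of psiA) (k : N -> Lstructure_of psiB) :
  embedding e -> embedding h -> (forall y, exists x, h x = y) -> embedding k ->
  exists2 f : A -> B, couple_embedding psiA psiB f &
    forall x a, h x = Some a -> k (e x) = Some (f a).
Proof.
move=> eE hE hsurj kE.
have /choice[f fP] : forall a, exists b, forall x, h x = Some a -> k (e x) = Some b.
  move=> a; have [x xa] := hsurj (Some a).
  case kx : (k (e x)) => [b|].
    by exists b => x'; rewrite -xa => /(emb_inj hE)->.
  have kinf : k (e x) = k (e (Linf M)) by rewrite kx (emb_inf eE) (emb_inf kE).
  have xinf : x = Linf M by apply/(emb_inj eE)/(emb_inj kE).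
  by move: xa; rewrite xinf (emb_inf hE).
exists f; last by move=> x a; exact: fP.
split.
- move=> a b; have [x xa] := hsurj (Some a); have [y yb] := hsurj (Some b).
  have : h (Ladd x y) = Some (a + b) by rewrite (emb_add hE) xa yb.
  move/fP; rewrite (emb_add eE) (emb_add kE) (fP _ _ xa) (fP _ _ yb).
  by case=> ->.
- move=> a b; have [x xa] := hsurj (Some a); have [y yb] := hsurj (Some b) => ab.
  have : Llt (h x) (h y) by rewrite xa yb.
  move/(emb_lt hE)/(emb_lt eE)/(emb_lt kE).
  by rewrite (fP _ _ xa) (fP _ _ yb).
- move=> a a0; have [x xa] := hsurj (Some a).
  have : h (Lpsi x) = Some (psiA a) by rewrite (emb_psi hE) xa /= (negPf a0).
  move/fP; rewrite (emb_psi eE) (emb_psi kE) (fP _ _ xa) /=.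
  by case: ifP => // _ [].
Qed.

(** * Saturation and the realization of the two types *)

Section Saturation.
Variables (M : Lstructure) (T : Type) (K : set T) (Par : set M).
Hypotheses (sat_M : succ_card_saturated K M) (ParK : Par #<= K).

Lemma saturated_family (I : choiceType) (i0 : I) (phi : I -> param_formula Par) :
  (forall l : seq I, exists x, forall k, k \in l -> sat_at x (phi k)) ->
  exists x, forall k, sat_at x (phi k).
Proof.
move=> fin; have [|x xP] := sat_M (A := Par) (Sigma := range phi) ParK.
  move=> F Ffin Fphi.
  have /choice[k kP] : forall p, exists k, F p -> p = phi k.
    move=> p; have [Fp|nFp] := pselect (F p); last by exists i0.
    by have [k _ kp] := Fphi _ Fp; exists k.
  have /finite_seqP[l lE] : finite_set (k @` F) by apply: finite_image.
  have [x xP] := fin l; exists x => p Fp; rewrite (kP p Fp); apply: xP.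
  have : [set` l] (k p) by rewrite -lE; exists p.
  by [].
by exists x => k; apply: xP; exists k.
Qed.

End Saturation.

Definition Fand V (p q : formula V) : formula V := Fimp (Fimp p (Fimp q (Fbot V))) (Fbot V).

(** [Q] is decided outside the language, so that every [a] contributes a formula, trivial where the
    constraint does not apply. *)
Definition Fif V (Q : Prop) (p : formula V) : formula V :=
  if pselect Q then p else Fimp (Fbot V) (Fbot V).

Lemma sat_Fand (M : Lstructure) V (e : V -> M) p q :
  sat e (Fand p q) <-> sat e p /\ sat e q.
Proof.
split=> /= [h|[hp hq] h]; last exact: h.
by split; apply: contrapT => n; apply: h => hp hq; apply: n.
Qed.

Lemma sat_Fif (M : Lstructure) V (e : V -> M) (Q : Prop) p :
  sat e (Fif Q p) <-> (Q -> sat e p).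
Proof. by rewrite /Fif; case: pselect => q; split=> //= h; apply: h. Qed.

Section Realization.
Variables (M : Lstructure) (T : Type) (K : set T) (Par : set M).
Hypotheses (sat_M : succ_card_saturated K M) (ParK : Par #<= K).
Variables (A C : oagType) (psiC : C -> C) (g : A -> C).
Variable h : M -> Lstructure_of psiC.
Hypotheses (hE : embedding h) (hsurj : forall y, exists x, h x = y).
Variable par : A -> {y : M | Par y}.
Hypothesis parE : forall a, h (proj1_sig (par a)) = Some (g a).

(** The condition on [phi 0] ensures that the realization is not infinity. *)
Lemma realize_family (phi : A -> param_formula Par) (Q : A -> C -> Prop) :
  (forall a x c, h x = Some c -> (sat_at x (phi a) <-> Q a c)) ->
  (forall x, h x = None -> ~ sat_at x (phi 0)) ->
  (forall l : seq A, exists c, forall a, a \in l -> Q a c) ->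
  exists c, forall a, Q a c.
Proof.
move=> phiQ phi0 fin; have [|x xP] := @saturated_family _ _ _ _ sat_M ParK A 0 phi.
  move=> l; have [c cP] := fin l; have [x xc] := hsurj (Some c).
  by exists x => a /cP Qa; apply/(phiQ _ _ _ xc).
case xc : (h x) => [c|]; last by case: (phi0 _ xc).
by exists c => a; apply/(phiQ _ _ _ xc).
Qed.

Local Notation X := (Var (None : option {y : M | Par y})).
Local Notation P a := (Var (Some (par a))).

Lemma sat_param_lt a x c : h x = Some c ->
  sat_at x (Flt (P a) X) <-> g a < c.
Proof. by move=> xc; rewrite /sat_at /=; split=> [/(emb_lt hE)|?]; [|apply/(emb_lt hE)]; rewrite parE xc. Qed.

Lemma sat_lt_param a x c : h x = Some c ->
  sat_at x (Flt X (P a)) <-> c < g a.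
Proof. by move=> xc; rewrite /sat_at /=; split=> [/(emb_lt hE)|?]; [|apply/(emb_lt hE)]; rewrite parE xc. Qed.

(** As [p] takes the value infinity elsewhere, membership in this set is an atomic condition. *)
Lemma sat_p_lt_inf x : sat_at x (Flt (Tp X) (Tinf _)) <->
  exists2 c, h x = Some c & Psi_gt_s0 psiC c.
Proof.
rewrite /sat_at /= (emb_lt hE) (emb_p hE) (emb_inf hE).
case: (h x) => [c|] /=; last by split=> // -[].
case: asboolP => cP /=; split=> //; first by move=> _; exists c.
by case=> _ [<-].
Qed.

(** [psi] is infinite at zero and at infinity while the parameter for [v] is finite, so the equation
    alone keeps [x] finite and different from [g a]. *)
Lemma sat_psi_eq a v x : sat_at x (Feq (Tpsi (Tadd X (Topp (P a)))) (P v)) <->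
  exists2 c, h x = Some c & c - g a != 0 /\ psiC (c - g a) = g v.
Proof.
have -> : sat_at x (Feq (Tpsi (Tadd X (Topp (P a)))) (P v)) <->
    h (Lpsi (Ladd x (Lopp (proj1_sig (par a))))) = h (proj1_sig (par v)).
  by rewrite /sat_at /=; split=> [->|/(emb_inj hE)].
rewrite (emb_psi hE) (emb_add hE) (emb_opp hE) !parE.
case: (h x) => [c|] /=; last by split=> // -[].
split=> [|[_ [<-] [/negPf-> ->]]//].
by case: ifPn => // n0 [<-]; exists c.
Qed.

Variables (B : oagType) (psiA : A -> A) (psiB : B -> B) (f : A -> B).
Hypotheses (TA : T0_model psiA) (TB : T0_model psiB) (TC : T0_model psiC).
Hypotheses (fE : couple_embedding psiA psiB f) (gE : couple_embedding psiA psiC g).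
Variable alpha : B.
Hypothesis alphaN : forall a, alpha <> f a.

(** If [m] in [Psi psiA] lies below [alpha], so does [s m], because [alpha] is in [Psi psiB] but not
    in the image of [f]. So the successor of the largest listed point below [alpha] meets finitely
    many conditions. *)
Lemma realize_cut : Psi psiB alpha ->
  exists beta, in_cut psiA psiC g (fun a => f a < alpha) beta.
Proof.
move=> Palpha.
pose phi a : param_formula Par := Fand (Flt (Tp X) (Tinf _))
  (Fand (Fif (Psi psiA a /\ f a < alpha) (Flt (P a) X))
        (Fif (Psi psiA a /\ alpha < f a) (Flt X (P a)))).
pose Q a c := [/\ Psi_gt_s0 psiC c, Psi psiA a /\ f a < alpha -> g a < c &
  Psi psiA a /\ alpha < f a -> c < g a].
have [|||beta betaP] := @realize_family phi Q.
- move=> a x c xc; rewrite /sat_at !sat_Fand !sat_Fif -!/(sat_at _ _).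
  rewrite (sat_param_lt a xc) (sat_lt_param a xc) sat_p_lt_inf xc.
  split=> [[[_ [<-] h1] [h2 h3]]|[h1 h2 h3]]; first by split.
  by split=> //; exists c.
- by move=> x xN; rewrite /sat_at sat_Fand -/(sat_at _ _) sat_p_lt_inf xN => -[[]].
- move=> l; pose D := fun a => `[< Psi psiA a >] && (f a < alpha).
  have s0P : D (successor psiA 0).
    apply/andP; split; first by apply/asboolP/Psi_s.
    rewrite (ce_s TA TB fE) (ce_0 fE).
    case: (Psi_cases TB Palpha) => [e|[y Py <-]]; last exact: s0_lt_s.
    by case: (alphaN (a := successor psiA 0)); rewrite (ce_s TA TB fE) (ce_0 fE).
  have letot : total (<=%O : rel A) by move=> x y; apply: oag_le_total.
  (* Prepending [s 0] ensures that there is a listed point below [alpha]. *)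
  have [no|[m [_ /andP[/asboolP Pm mal] mmax]]] :=
    seq_maximum D (successor psiA 0 :: l) letot le_trans.
    by have := no _ (mem_head _ _); rewrite s0P.
  have smal : f (successor psiA m) < alpha.
    have Pfm : Psi psiB (f m) by apply/(ce_PsiE TA TB fE).
    rewrite (ce_s TA TB fE) lt_neqAle (Psi_s_le TB) // andbT.
    by apply/eqP => e; case: (alphaN (a := successor psiA m)); rewrite (ce_s TA TB fE).
  exists (g (successor psiA m)) => a al; split.
  + rewrite (ce_s TA TC gE); split; first exact: Psi_s.
    by apply: s0_lt_s => //; apply/(ce_PsiE TA TC gE).
  + move=> [Pa aal]; rewrite (ce_ltE gE).
    apply: le_lt_trans (Psi_lt_s TA Pm); apply: mmax.
      by rewrite inE al orbT.
    by apply/andP; split=> //; apply/asboolP.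
  + by move=> [Pa aal]; rewrite (ce_ltE gE) -(ce_ltE fE); apply: lt_trans aal.
have lt_iff a : Psi psiA a -> (f a < alpha <-> g a < beta).
  move=> Pa; have [_ h1 h2] := betaP a; split=> [aal|]; first exact: h1.
  case: (oag_ltP (f a) alpha) => // [e|aal]; first by case: (alphaN (esym e)).
  by move/(lt_trans (h2 (conj Pa aal))); rewrite ltxx.
have Pb : Psi psiC beta by have [[]] := betaP 0.
exists beta; split=> // a e.
have Pa : Psi psiA a by apply/(ce_PsiE TA TC gE); rewrite -e.
have [_ h1 h2] := betaP a.
case: (oag_ltP (f a) alpha) => [aal|e2|aal].
- by have := h1 (conj Pa aal); rewrite e ltxx.
- by case: (alphaN (esym e2)).
- by have := h2 (conj Pa aal); rewrite e ltxx.
Qed.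

Lemma realize_near : (forall x, Psi psiB x -> exists a, x = f a) ->
  exists beta, forall a v, f v = psiB (alpha - f a) ->
     [/\ f a < alpha -> g a < beta, alpha < f a -> beta < g a &
         psiC (beta - g a) = g v].
Proof.
move=> sub.
have /choice[v vP] : forall a, exists v, f v = psiB (alpha - f a).
  by move=> a; have [v _ vE] := psi_alpha TA TB fE sub alphaN a; exists v.
pose phi a : param_formula Par := Fand (Feq (Tpsi (Tadd X (Topp (P a)))) (P (v a)))
  (Fand (Fif (f a < alpha) (Flt (P a) X)) (Fif (alpha < f a) (Flt X (P a)))).
pose Q a c := [/\ f a < alpha -> g a < c, alpha < f a -> c < g a &
  c - g a != 0 /\ psiC (c - g a) = g (v a)].
have [|||beta betaP] := @realize_family phi Q.
- move=> a x c xc; rewrite /sat_at !sat_Fand !sat_Fif -!/(sat_at _ _).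
  rewrite (sat_param_lt a xc) (sat_lt_param a xc) sat_psi_eq xc.
  split=> [[[_ [<-] h1] [h2 h3]]|[h1 h2 h3]]; first by split.
  by split=> //; exists c.
- by move=> x xN; rewrite /sat_at sat_Fand -/(sat_at _ _) sat_psi_eq xN => -[[]].
- move=> l; have [b bP] := near_alpha_seq TA TB fE sub alphaN l.
  exists (g b) => a al; have [h1 h2 h3] := bP a al.
  have ba : b - a != 0.
    rewrite subr_eq0; case: (oag_ltP (f a) alpha) => [/h1/gt_eqF->|e|/h2/lt_eqF->] //.
    by case: (alphaN (esym e)).
  split; rewrite ?(ce_ltE gE) //.
  rewrite -(ce_B gE) (ce_neq0 gE) -(ce_psi gE) //; split=> //.
  by congr g; apply: (ce_inj fE); rewrite h3 vP.
exists beta => a w wE; have [h1 h2 [_ h3]] := betaP a; split=> //.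
by rewrite h3; congr g; apply: (ce_inj fE); rewrite vP.
Qed.

End Realization.

Theorem theorem5p2 (G1 Gstar : Lstructure) (G0 : substructure G1)
    (i : induced G0 -> Gstar)
    (hG0 : Tlog_model (induced G0))
    (hG1 : Tlog_model G1)
    (hproper : exists x : G1, ~ G0 x)
    (hGstar : Tlog_model Gstar)
    (hsat : succ_card_saturated [set x : G1 | x <> Linf G1] Gstar)
    (hi : embedding i) :
  exists alpha : G1, ~ G0 alpha /\
    exists (G : substructure G1) (j : induced G -> Gstar),
      [/\ forall x : G1, G0 x -> G x, G alpha, embedding j &
          forall (x : induced G0) (y : induced G),
            proj1_sig y = proj1_sig x -> j y = i x].
Proof.
have [A [psiA [TA [h0 [h0E h0s]]]]] := hG0.
have [B [psiB [TB [h1 [h1E h1s]]]]] := hG1.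
have [C [psiC [TC [h2 [h2E h2s]]]]] := hGstar.
have [f fE fP] := embedding_couple (induced_embedding G0) h0E h0s h1E.
have [g gE gP] := embedding_couple hi h0E h0s h2E.
(* In these coordinates [G0] is the image of [f] together with infinity. *)
have outside x b : h1 x = Some b -> (~ G0 x <-> forall a, b <> f a).
  move=> xb; split=> [nx a ba|nb Gx].
    have [y ya] := h0s (Some a); apply: nx.
    suff -> : x = proj1_sig y by case: y {ya}.
    by apply: (emb_inj h1E); rewrite (fP _ _ ya) xb ba.
  case ya : (h0 (exist _ x Gx)) => [a|].
    by have := fP _ _ ya; rewrite /= xb => -[]; apply: nb.
  have xinf : exist _ x Gx = Linf (induced G0).
    by apply: (emb_inj h0E); rewrite ya (emb_inf h0E).
  have /= xi := congr1 (@proj1_sig _ _) xinf.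
  by move: xb; rewrite xi (emb_inf h1E).
(* The parameters are presented as an image of the finite elements of [G1], which makes the
   cardinality bound immediate; points outside [G0] get infinity as a default value. *)
pose lift x := if pselect (G0 x) is left Gx then i (exist _ x Gx) else Linf Gstar.
pose Par : set Gstar := lift @` [set x : G1 | x <> Linf G1].
have ParK : Par #<= [set x : G1 | x <> Linf G1] by apply: card_image_le.
have /choice[par parE] : forall a, exists q : {y | Par y}, h2 (proj1_sig q) = Some (g a).
  move=> a; have [y ya] := h0s (Some a).
  have yPar : Par (i y).
    exists (proj1_sig y) => /=.
      move=> yi; have := fP _ _ ya; by rewrite yi (emb_inf h1E).
    rewrite /lift; case: pselect => [Gy|]; last by case: y {ya}.
    by congr i; apply: sval_injective.
  by exists (exist _ _ yPar); apply: gP.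
(* A new value of [psi] is taken as [alpha] if there is one; otherwise any element outside [G0]
   serves. *)
have [R [alpha [[E alphaN] [beta ab]]]] : exists (R : B -> C -> Prop) alpha,
    [/\ extension psiB psiC f g R & forall a, alpha <> f a] /\ exists beta, R alpha beta.
  have [[alpha [Pa alphaN]]|noPsi] :=
    pselect (exists alpha, Psi psiB alpha /\ forall a, alpha <> f a).
    have [beta betaP] := realize_cut hsat ParK h2E h2s parE TA TB TC fE gE alphaN Pa.
    have alphaP : in_cut psiA psiB f (fun a => f a < alpha) alpha by split.
    have [c [c0 cP cs]] := chain_exists TA TB fE alphaP.
    have [d [d0 dP ds]] := chain_exists TA TC gE betaP.
    exists (chain_ext f g c d), alpha; split.
      by split=> //; apply: (new_Psi_extension TA TB TC fE gE cP dP cs ds).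
    by exists beta; rewrite -c0 -d0; apply: (chain_ext_c TA TB TC fE gE cP dP cs ds).
  have sub x : Psi psiB x -> exists a, x = f a.
    move=> Px; apply: contrapT => nx; apply: noPsi; exists x; split=> // a xa.
    by apply: nx; exists a.
  have [x nx] := hproper.
  case xb : (h1 x) => [alpha|]; last first.
    case: nx; suff -> : x = Linf G1 by apply: sub_inf.
    by apply: (emb_inj h1E); rewrite xb (emb_inf h1E).
  have alphaN := (outside _ _ xb).1 nx.
  have [beta betaP] := realize_near hsat ParK h2E h2s parE TA TB fE gE alphaN sub.
  have I := base_iso TA fE gE.
  exists (adjoin (base_rel f g) alpha beta), alpha; split.
    by split=> //; apply: (same_psi_extension TA TB fE sub alphaN TC gE betaP).
  by exists beta; apply: adjoin_gen; apply: pi_linear I.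
(* [S] will be the graph of [j], and its domain the substructure sought. *)
pose S x y := option_rel R (h1 x) (h2 y).
have Sfun x y y' : S x y -> S x y' -> y = y'.
  by move=> xy xy'; apply: (emb_inj h2E); apply: (option_rel_fun E xy xy').
have Sinj x x' y : S x y -> S x' y -> x = x'.
  by move=> xy xy'; apply: (emb_inj h1E); apply: (option_rel_inj E xy xy').
have Sadd x y x' y' : S x y -> S x' y' -> S (Ladd x x') (Ladd y y').
  by rewrite /S (emb_add h1E) (emb_add h2E); apply: (option_rel_add E).
have Sopp x y : S x y -> S (Lopp x) (Lopp y).
  by rewrite /S (emb_opp h1E) (emb_opp h2E); apply: (option_rel_opp E).
have Spsi x y : S x y -> S (Lpsi x) (Lpsi y).
  by rewrite /S (emb_psi h1E) (emb_psi h2E); apply: (option_rel_psi E).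
have Ss x y : S x y -> S (Ls x) (Ls y).
  by rewrite /S (emb_s h1E) (emb_s h2E); apply: (option_rel_s TB TC E).
have Sp x y : S x y -> S (Lp x) (Lp y).
  by rewrite /S (emb_p h1E) (emb_p h2E); apply: (option_rel_p TB TC E).
have Sdelta n x y : S x y -> S (Ldelta n x) (Ldelta n y).
  by rewrite /S (emb_delta h1E) (emb_delta h2E); apply: (option_rel_delta TB TC E).
have S0 : S (Lzero G1) (Lzero Gstar).
  by rewrite /S (emb_zero h1E) (emb_zero h2E); apply: lr_0; apply: pi_linear (ext_iso E).
have Sinf : S (Linf G1) (Linf Gstar) by rewrite /S (emb_inf h1E) (emb_inf h2E).
have Si (x : induced G0) : S (proj1_sig x) (i x).
  case xa : (h0 x) => [a|]; first by rewrite /S (fP _ _ xa) (gP _ _ xa); apply: ext_base E _.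
  have -> : x = Linf (induced G0) by apply: (emb_inj h0E); rewrite xa (emb_inf h0E).
  by rewrite (emb_inf hi).
pose D x := exists y, S x y.
have D0 : D (Lzero G1) by exists (Lzero Gstar).
have Dinf : D (Linf G1) by exists (Linf Gstar).
have Dadd x x' : D x -> D x' -> D (Ladd x x').
  by move=> [y xy] [y' xy']; exists (Ladd y y'); apply: Sadd.
have Dopp x : D x -> D (Lopp x) by move=> [y xy]; exists (Lopp y); apply: Sopp.
have Dpsi x : D x -> D (Lpsi x) by move=> [y xy]; exists (Lpsi y); apply: Spsi.
have Ds x : D x -> D (Ls x) by move=> [y xy]; exists (Ls y); apply: Ss.
have Dp x : D x -> D (Lp x) by move=> [y xy]; exists (Lp y); apply: Sp.
have Ddelta n x : D x -> D (Ldelta n x).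
  by move=> [y xy]; exists (Ldelta n y); apply: Sdelta.
pose G := Build_substructure D0 Dinf Dadd Dopp Dpsi Ds Dp Ddelta.
have /choice[j jP] : forall x : induced G, exists y, S (proj1_sig x) y by case.
have [x xalpha] := h1s (Some alpha); have [y ybeta] := h2s (Some beta).
exists x; split; first by apply/(outside _ _ xalpha).
exists G, j; split.
- by move=> z Gz; exists (i (exist _ z Gz)); apply: (Si (exist _ z Gz)).
- by exists y; rewrite /S xalpha ybeta.
- split.
  + by move=> z z' e; apply: sval_injective; apply: Sinj (jP z) _; rewrite e.
  + by apply: Sfun (jP _) _.
  + by apply: Sfun (jP _) _.
  + by move=> z z'; apply: Sfun (jP _) _; apply: Sadd.
  + by move=> z; apply: Sfun (jP _) _; apply: Sopp.
  + move=> z z'; rewrite /= (emb_lt h1E) (emb_lt h2E).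
    exact: (option_rel_lt E (jP z) (jP z')).
  + by move=> z; apply: Sfun (jP _) _; apply: Spsi.
  + by move=> z; apply: Sfun (jP _) _; apply: Ss.
  + by move=> z; apply: Sfun (jP _) _; apply: Sp.
  + by move=> n z; apply: Sfun (jP _) _; apply: Sdelta.
- by move=> z z' e; apply: Sfun (jP z') _; rewrite e.
Qed.
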